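(* No $\mathbb{Z}_2$-lattice of rank $8$ is primitively $4$-universal. Therefore, $u^\ast_{\mathbb{Z}_2}(4) = 9$.
   Context: A $\mathbb{Z}_2$-lattice is a finitely generated $\mathbb{Z}_2$-submodule of a quadratic space $(V,B)$ over $\mathbb{Q}_2$, assumed integral ($B(L,L)\subseteq\mathbb{Z}_2$) and nondegenerate. A representation is a $\mathbb{Z}_2$-linear map preserving $B$; it is primitive if its image is a direct summand. A lattice is primitively $n$-universal if it primitively represents every $\mathbb{Z}_2$-lattice of rank $n$; $u^\ast_{\mathbb{Z}_2}(n)$ is the minimal rank of such a lattice. *)

(* Defs.v *)
From HB Require Import structures.
From mathcomp Require Import all_boot all_order all_algebra.
From mathcomp Require Import boolp.
Set Implicit Arguments. Unset Strict Implicit. Unset Printing Implicit Defensive.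
Import Order.TTheory GRing.Theory Num.Theory.
Local Open Scope ring_scope.

(* The ring Z_2 of 2-adic integers, as the inverse limit of the Z/2^k Z:     *)
(* a 2-adic integer is a sequence (x_k)_k of residues with x_k in [0,2^k)    *)
(* and x_k = x_{k+1} mod 2^k (the range condition is implied).               *)

Definition pw (k : nat) : int := (2 ^ k)%:Z.

Record Z2 := MkZ2 { z2seq : nat -> int ;
                    z2compat : forall k, z2seq k = (z2seq k.+1 %% pw k)%Z }.

Lemma Z2_eq (x y : Z2) : z2seq x =1 z2seq y -> x = y.
Proof.
case: x y => [f fP] [g gP] /= E.
have /funext efg : forall k, f k = g k by [].
subst g; congr MkZ2; exact: Prop_irrelevance.
Qed.

HB.instance Definition _ := gen_eqMixin Z2.
HB.instance Definition _ := gen_choiceMixin Z2.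

Lemma pw_gt0 k : 0 < pw k.
Proof. by rewrite /pw ltz_nat expn_gt0. Qed.

Lemma pw_neq0 k : pw k != 0.
Proof. by rewrite gt_eqF // pw_gt0. Qed.

Lemma pwS k : pw k.+1 = 2 * pw k.
Proof. by rewrite /pw expnS PoszM. Qed.

Lemma modz_pwS (a : int) k : ((a %% pw k.+1)%Z %% pw k)%Z = (a %% pw k)%Z.
Proof.
by rewrite [in RHS](divz_eq a (pw k.+1)) [X in _ * X]pwS mulrA modzMDl.
Qed.


Section Lift.
Variable op : int -> int -> int.
Hypothesis op_mod : forall a b m, m != 0 ->
  (op (a %% m)%Z (b %% m)%Z %% m = op a b %% m)%Z.

Definition z2op (x y : Z2) : Z2.
Proof.
refine (@MkZ2 (fun k => (op (z2seq x k) (z2seq y k) %% pw k)%Z) _).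
move=> k; rewrite modz_pwS -[in RHS]op_mod ?pw_neq0 //.
by rewrite -!z2compat.
Defined.
End Lift.

Lemma addz_mod (a b m : int) : m != 0 -> (((a %% m)%Z + (b %% m)%Z) %% m = (a + b) %% m)%Z.
Proof. by move=> _; rewrite modzDml modzDmr. Qed.
Lemma mulz_mod (a b m : int) : m != 0 -> (((a %% m)%Z * (b %% m)%Z) %% m = (a * b) %% m)%Z.
Proof. by move=> _; rewrite modzMml modzMmr. Qed.
Lemma oppz_mod (a b m : int) : m != 0 -> ((- (a %% m)%Z) %% m = (- a) %% m)%Z.
Proof. by move=> _; rewrite modzNm. Qed.

Definition z2const (c : int) : Z2.
Proof.
refine (@MkZ2 (fun k => (c %% pw k)%Z) _).
by move=> k; rewrite modz_pwS.
Defined.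

Definition z2zero := z2const 0.
Definition z2one := z2const 1.
Definition z2add := z2op (@addz_mod).
Definition z2mul := z2op (@mulz_mod).
Definition z2opp (x : Z2) : Z2 := z2op (op := fun a _ => - a)
  (fun a b m _ => modzNm a m) x x.

Lemma z2seqK (x : Z2) k : (z2seq x k %% pw k)%Z = z2seq x k.
Proof. by rewrite z2compat modz_mod -z2compat. Qed.

Lemma z2addA : associative z2add.
Proof. by move=> x y z; apply: Z2_eq => k /=; rewrite modzDml modzDmr addrA. Qed.
Lemma z2addC : commutative z2add.
Proof. by move=> x y; apply: Z2_eq => k /=; rewrite addrC. Qed.
Lemma z2add0 : left_id z2zero z2add.
Proof. by move=> x; apply: Z2_eq => k /=; rewrite modzDml add0r z2seqK. Qed.
Lemma z2addN : left_inverse z2zero z2opp z2add.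
Proof. by move=> x; apply: Z2_eq => k /=; rewrite modzDml addNr. Qed.

HB.instance Definition _ := GRing.isZmodule.Build Z2 z2addA z2addC z2add0 z2addN.

Lemma z2mulA : associative z2mul.
Proof. by move=> x y z; apply: Z2_eq => k /=; rewrite modzMml modzMmr mulrA. Qed.
Lemma z2mulC : commutative z2mul.
Proof. by move=> x y; apply: Z2_eq => k /=; rewrite mulrC. Qed.
Lemma z2mul1 : left_id z2one z2mul.
Proof. by move=> x; apply: Z2_eq => k /=; rewrite modzMml mul1r z2seqK. Qed.
Lemma z2mulDl : left_distributive z2mul z2add.
Proof.
by move=> x y z; apply: Z2_eq => k /=; rewrite modzMml modzDml modzDmr mulrDl.
Qed.
Lemma z2one_neq0 : z2one != z2zero.
Proof.
apply/eqP => /(congr1 (fun x => z2seq x 1)) /=.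
by rewrite /pw /= expn1.
Qed.

HB.instance Definition _ :=
  GRing.Zmodule_isComNzRing.Build Z2 z2mulA z2mulC z2mul1 z2mulDl z2one_neq0.

(* Z_2-lattices.  A (nondegenerate, integral) Z_2-lattice of rank n is free  *)
(* (Z_2 is a PID), so it is described, up to isometry, by its Gram matrix    *)
(* with respect to a basis: a symmetric n x n matrix over Z_2 with nonzero   *)
(* determinant (nondegeneracy of B on L, i.e. on V = Q_2 L).                 *)

Definition is_lattice (n : nat) (G : 'M[Z2]_n) : Prop :=
  G^T = G /\ \det G != 0.

(* A representation of the lattice with Gram matrix A (rank n) by the       *)
(* lattice with Gram matrix G (rank m): a Z_2-linear map Z_2^n -> Z_2^m,     *)
(* given by an m x n matrix X (column j = image of the j-th basis vector),   *)
(* preserving the bilinear forms: X^T G X = A.                               *)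
Definition represents_by (n m : nat) (G : 'M[Z2]_m) (A : 'M[Z2]_n)
  (X : 'M[Z2]_(m, n)) : Prop := X^T *m G *m X = A.

Definition is_submodule (m : nat) (S : 'cV[Z2]_m -> Prop) : Prop :=
  S 0 /\ (forall u v, S u -> S v -> S (u + v)) /\
  (forall (a : Z2) u, S u -> S (a *: u)).

Definition is_direct_summand (m : nat) (S : 'cV[Z2]_m -> Prop) : Prop :=
  exists C : 'cV[Z2]_m -> Prop, is_submodule C /\
    (forall v, exists s c, S s /\ C c /\ v = s + c) /\
    (forall v, S v -> C v -> v = 0).

Definition image_of (m n : nat) (X : 'M[Z2]_(m, n)) : 'cV[Z2]_m -> Prop :=
  fun v => exists u : 'cV[Z2]_n, v = X *m u.

Definition prim_represents (n m : nat) (G : 'M[Z2]_m) (A : 'M[Z2]_n) : Prop :=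
  exists X : 'M[Z2]_(m, n), represents_by G A X /\ is_direct_summand (image_of X).

Definition prim_universal (n m : nat) (G : 'M[Z2]_m) : Prop :=
  forall A : 'M[Z2]_n, is_lattice A -> prim_represents G A.

Definition u_star_Z2_is (n r : nat) : Prop :=
  (exists G : 'M[Z2]_r, is_lattice G /\ prim_universal n G) /\
  (forall (r' : nat) (G : 'M[Z2]_r'), (r' < r)%N -> is_lattice G ->
     ~ prim_universal n G).

(* Main.v *)
Require Import Defs.
From HB Require Import structures.
From mathcomp Require Import all_boot all_order all_algebra.
From mathcomp Require Import boolp.
From mathcomp Require Import ring zify.
Set Implicit Arguments. Unset Strict Implicit. Unset Printing Implicit Defensive.
Import Order.TTheory GRing.Theory Num.Theory.
Local Open Scope ring_scope.

(** Rank 9: for any [A] choose [w] with [w_i = A_ii] mod 2; then [A - w w^T] has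
    even diagonal, hence is [U + U^T], and the columns of [(1; U; w^T)] represent
    [A] primitively in [H^4 + <1>], where [H] is the hyperbolic plane.

    Rank 8: let [K = A_2 + 2 A_2], i.e. twice the norm form of the maximal order of
    the quaternion division algebra; [Q_K / 2] is never divisible by 4 at primitive
    vectors.  A primitively 4-universal [G] is [H + H + N], and since hyperbolic
    planes cancel, a primitive copy of [2^j K] (j > 0) yields a primitive plane in
    [N] on which [Q] has only the valuations [j + 1] and [j + 2].
    If [N = H + N_2], the same step once more gives vectors of [N_2] with these
    valuations for all [j], forcing [N_2 = <d, n>] with [8 | d + n]; then [K] itself
    is not represented.  Otherwise [N] is the sum of a plane [D] whose primitive
    vectors have values of valuation 0 or 1 (a ramified norm form) and a plane
    [N_2], and the planes found above are graphs of maps [S_j : N_2 -> D].  For large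
    [j] this gives [N_2 = - D o T] up to a high power of 2, so that
    [D o S_j - D o T] is 2^(j+1) times a form not divisible by 4 at primitive
    vectors, for all small [j]; this fails for the one [j] determined by the largest
    valuation of [D o T]. *)

(** * Residues, parity and halving of 2-adic integers *)

Lemma z2seq0 (x : Z2) : z2seq x 0 = 0.
Proof. by rewrite z2compat modz1. Qed.

Lemma z2seqD (x y : Z2) k : z2seq (x + y) k = ((z2seq x k + z2seq y k) %% pw k)%Z.
Proof. reflexivity. Qed.

Lemma z2seqM (x y : Z2) k : z2seq (x * y) k = ((z2seq x k * z2seq y k) %% pw k)%Z.
Proof. reflexivity. Qed.

Lemma z2seq_dbl (x : Z2) k : z2seq (x *+ 2) k.+1 = 2 * z2seq x k.
Proof.
rewrite mulr2n z2seqD [in RHS]z2compat pwS mulz_modr //.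
by congr (_ %% _)%Z; ring.
Qed.

(** Each application of [f] settles one more binary digit, so the residue modulo 2^k is final after
    k iterations from 0; these residues form the limit. *)
Lemma z2_fixpoint (f : Z2 -> Z2) :
  (forall k x y, z2seq x k = z2seq y k -> z2seq (f x) k.+1 = z2seq (f y) k.+1) ->
  exists x, f x = x.
Proof.
move=> fP.
have iterP k : z2seq (iter k f 0) k = z2seq (iter k.+1 f 0) k.
  elim: k => [|k IH]; first by rewrite !z2seq0.
  by rewrite !iterS; apply: fP; rewrite -iterS.
have limP k : z2seq (iter k f 0) k = (z2seq (iter k.+1 f 0%R) k.+1 %% pw k)%Z.
  by rewrite -z2compat iterP.
exists (MkZ2 limP); apply: Z2_eq => -[|k]; first by rewrite !z2seq0.
exact: (fP k _ (iter k f 0)).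
Qed.

(* [x |-> a + 2 g x] is a contraction as soon as [g] is nonexpanding. *)
Lemma z2_fixpoint2 (a : Z2) (g : Z2 -> Z2) :
  (forall k x y, z2seq x k = z2seq y k -> z2seq (g x) k = z2seq (g y) k) ->
  exists x, x = a + g x *+ 2.
Proof.
move=> gP; have [|x xP] := @z2_fixpoint (fun x => a + g x *+ 2); last by exists x.
by move=> k x y xy; rewrite z2seqD z2seq_dbl (gP _ _ _ xy) -z2seq_dbl -z2seqD.
Qed.

Definition par (x : Z2) : bool := z2seq x 1 == 1.

Lemma z2seq1 (x : Z2) : z2seq x 1 = (par x : nat)%:Z.
Proof.
rewrite /par; have := z2seqK x 1; rewrite (_ : pw 1 = 2) //.
have := modz_ge0 (z2seq x 1) (isT : 2 != 0 :> int).
have := ltz_pmod (z2seq x 1) (isT : 0 < 2 :> int).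
by case: eqP; lia.
Qed.

Lemma par0 : par 0 = false.
Proof. by []. Qed.

Lemma par1 : par 1 = true.
Proof. by []. Qed.

Lemma parD x y : par (x + y) = par x (+) par y.
Proof. by rewrite {1}/par z2seqD !z2seq1; case: (par x); case: (par y). Qed.

Lemma parM x y : par (x * y) = par x && par y.
Proof. by rewrite {1}/par z2seqM !z2seq1; case: (par x); case: (par y). Qed.

Lemma parN x : par (- x) = par x.
Proof. by have := parD x (- x); rewrite subrr par0; case: (par x); case: (par (- x)). Qed.

Lemma parX x n : par (x ^+ n) = par x || (n == 0%N).
Proof. by elim: n => [|n IH]; rewrite ?expr0 ?orbT // exprS parM IH; case: (par x). Qed.

Lemma par_dbl x : par (x *+ 2) = false.
Proof. by rewrite mulr2n parD addbb. Qed.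

Lemma par_nat n : par n%:R = odd n.
Proof. by elim: n => // n IH; rewrite -natr1 parD IH par1 addbT. Qed.

Lemma par2 : par 2%:R = false. Proof. by rewrite par_nat. Qed.

Definition parE := (parD, parM, parN, parX, par_nat, par_dbl, par0, par1).

(** The residue of the quotient modulo 2^k is half the residue of [x] modulo 2^(k+1); [divmod] makes
    the halved residues compatible. *)
Lemma z2_half x : par x = false -> exists y, x = 2%:R * y.
Proof.
move=> px.
have divmod (a d : int) : (0 < d) -> (((a %% (2 * d))%Z %/ 2)%Z = ((a %/ 2)%Z %% d)%Z).
  move=> d0; rewrite [a in LHS](divz_eq a 2) [(a %/ 2)%Z in LHS](divz_eq (a %/ 2)%Z d).
  set q := ((a %/ 2)%Z %/ d)%Z; set r := ((a %/ 2)%Z %% d)%Z; set s := (a %% 2)%Z.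
  have s_ge0 : 0 <= s by apply: modz_ge0.
  have s_lt2 : s < 2 by apply: ltz_pmod.
  have r_ge0 : 0 <= r by apply: modz_ge0; rewrite gt_eqF.
  have r_lt : r < d by apply: ltz_pmod.
  have -> : (q * d + r) * 2 + s = q * (2 * d) + (r * 2 + s) by ring.
  rewrite modzMDl modz_small; last by lia.
  by rewrite divzMDl // divz_small ?addr0 // s_ge0.
have hP k : (z2seq x k.+1 %/ 2)%Z = ((z2seq x k.+2 %/ 2)%Z %% pw k)%Z.
  by rewrite [z2seq x k.+1]z2compat pwS divmod // pw_gt0.
exists (MkZ2 hP); rewrite mulr_natl; apply: Z2_eq => -[|k]; first by rewrite !z2seq0.
rewrite z2seq_dbl /=.
have even_seq : (z2seq x k.+1 %% 2)%Z = 0.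
  elim: k => [|k IH]; first by rewrite z2seq1 px.
  have := IH; rewrite z2compat pwS.
  rewrite [z2seq x k.+2 in X in _ -> X](divz_eq _ (2 * pw k)) => IH2.
  by rewrite mulrCA mulrC modzMDl.
by rewrite [LHS](divz_eq _ 2) even_seq addr0 mulrC.
Qed.

(** * Z_2 as a local integral domain with residue field F_2 *)

Lemma z2_dbl_eq0 (x : Z2) : x *+ 2 = 0 -> x = 0.
Proof.
move=> x2; apply: Z2_eq => k; have := z2seq_dbl x k.
rewrite x2; have -> : z2seq 0 k.+1 = 0 by rewrite /= mod0z.
by rewrite /= mod0z; lia.
Qed.

Lemma z2_dbl_inj (x y : Z2) : 2%:R * x = 2%:R * y -> x = y.
Proof.
move=> /eqP; rewrite -subr_eq0 -mulrBr mulr_natl => /eqP /z2_dbl_eq0 /eqP.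
by rewrite subr_eq0 => /eqP.
Qed.

Lemma par_odd x : par x -> exists y, x = 1 + 2%:R * y.
Proof.
move=> px; have [|y yE] := @z2_half (x - 1); first by rewrite !parE px.
by exists y; rewrite -yE; ring.
Qed.

(** The inverse of 1 + 2a is the fixed point of the contraction y -> 1 - 2ay. *)
Lemma z2_inv x : par x -> exists y, y * x == 1.
Proof.
case/par_odd=> a ->.
have [|y yE] := @z2_fixpoint2 1 (fun y => - (a * y)).
  by move=> k u v uv; rewrite -!mulNr !z2seqM uv.
exists y; have -> : y * (1 + 2%:R * a) = 1 + (y - (1 + - (a * y) *+ 2)) by ring.
by rewrite -yE subrr addr0.
Qed.

Lemma z2_decomp (x : Z2) : x != 0 -> exists k u, par u /\ x = 2%:R ^+ k * u.
Proof.
move=> x0; have [k] : exists k, z2seq x k != 0.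
  apply: contrapT => /forallNP H; case/eqP: x0; apply: Z2_eq => k.
  by have /negP := H k; rewrite negbK => /eqP ->; rewrite /= mod0z.
elim: k x {x0} => [|k IH] x; first by rewrite z2seq0.
case px: (par x); first by exists 0%N, x; rewrite expr0 mul1r.
have [y xE] := z2_half px; rewrite xE mulr_natl z2seq_dbl.
rewrite mulf_eq0 /= => /IH[i [u [pu ->]]].
by exists i.+1, u; split => //; rewrite exprS; ring.
Qed.

Lemma z2_exp_eq0 k (x : Z2) : 2%:R ^+ k * x = 0 -> x = 0.
Proof.
elim: k => [|k IH]; first by rewrite expr0 mul1r.
rewrite exprS -mulrA => H; apply: IH; apply: z2_dbl_inj.
by rewrite H mulr0.
Qed.

Lemma z2_idomain (x y : Z2) : x * y = 0 -> (x == 0) || (y == 0).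
Proof.
move=> xy0; apply: contraT; rewrite negb_or => /andP[x0 y0].
have [i [u [pu xE]]] := z2_decomp x0; have [j [v [pv yE]]] := z2_decomp y0.
have /(@z2_exp_eq0 (i + j)) uv0 : 2%:R ^+ (i + j) * (u * v) = 0.
  by rewrite -[RHS]xy0 xE yE exprD; ring.
by have := parM u v; rewrite uv0 pu pv.
Qed.

Definition z2inv (x : Z2) : Z2 :=
  if pselect (par x) is left px then xchoose (z2_inv px) else x.

Fact z2_mulVx : {in par, left_inverse 1 z2inv *%R}.
Proof.
move=> x px; rewrite /z2inv; case: pselect => // px'.
exact/eqP/(xchooseP (z2_inv px')).
Qed.

Fact z2_unitP (x y : Z2) : y * x = 1 -> x \in par.
Proof. by move=> /(congr1 par); rewrite !parE unfold_in => /andP[]. Qed.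

Fact z2_inv_out : {in [predC par], z2inv =1 id}.
Proof. by move=> x /negP px; rewrite /z2inv; case: pselect. Qed.

HB.instance Definition _ :=
  GRing.ComNzRing_hasMulInverse.Build Z2 z2_mulVx z2_unitP z2_inv_out.
HB.instance Definition _ := GRing.ComUnitRing_isIntegral.Build Z2 z2_idomain.

Lemma unitZ2 (x : Z2) : (x \is a GRing.unit) = par x.
Proof. by []. Qed.

Lemma z2_2neq0 : (2%:R : Z2) != 0.
Proof.
apply/eqP => two0; have one0 : (1 : Z2) = 0.
  by apply: (@z2_exp_eq0 1); rewrite mulr1 expr1.
by have := par1; rewrite one0.
Qed.

Definition red2 (x : Z2) : 'F_2 := (par x)%:R.

Fact red2_zmod : zmod_morphism red2.
Proof. by move=> x y; rewrite /red2 !parE; case: (par x); case: (par y); apply/val_inj. Qed.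

Fact red2_monoid : monoid_morphism red2.
Proof.
by split=> [|x y]; rewrite /red2 !parE //; case: (par x); case: (par y); apply/val_inj.
Qed.

HB.instance Definition _ := GRing.isZmodMorphism.Build Z2 'F_2 red2 red2_zmod.
HB.instance Definition _ := GRing.isMonoidMorphism.Build Z2 'F_2 red2 red2_monoid.

Lemma red2_eq0 x : (red2 x == 0) = ~~ par x.
Proof. by rewrite /red2; case: (par x). Qed.

Definition lift2 (a : 'F_2) : Z2 := (a : nat)%:R.

Lemma lift2K : cancel lift2 red2.
Proof.
by move=> a; rewrite /red2 /lift2 par_nat; apply: val_inj; case: a => -[|[|n]].
Qed.

(** * Primitive matrices *)

Definition ev m (v : 'cV[Z2]_m) : Prop := exists w, v = 2%:R *: w.

(** Injectivity modulo 2. As Z_2 is local, this says that [X] is injective with a direct summand as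
    image; in this form primitivity is linear algebra over F_2. *)
Definition prim m k (X : 'M[Z2]_(m, k)) : Prop :=
  forall c : 'cV_k, ev (X *m c) -> ev c.

Lemma ev_red m (v : 'cV[Z2]_m) : ev v <-> map_mx red2 v = 0.
Proof.
split=> [[w ->]|/matrixP v0].
  by apply/matrixP => i j; rewrite !mxE; apply/eqP; rewrite red2_eq0 !parE.
have /choice[f fP] : forall i, exists y, v i 0 = 2%:R * y.
  move=> i; apply: z2_half; apply/negbTE.
  by rewrite -red2_eq0; have := v0 i 0; rewrite !mxE => ->.
by exists (\col_i f i); apply/matrixP => i j; rewrite !mxE (ord1 j) fP.
Qed.

Lemma evP m (v : 'cV[Z2]_m) : ev v <-> forall i, par (v i 0) = false.
Proof.
split=> [[w ->] i|H]; first by rewrite mxE !parE.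
apply/ev_red/matrixP => i j; rewrite !mxE (ord1 j); apply/eqP.
by rewrite red2_eq0 H.
Qed.

Lemma ev_dbl m (v : 'cV[Z2]_m) : ev (2%:R *: v).
Proof. by exists v. Qed.

Lemma evD m (u v : 'cV[Z2]_m) : ev u -> ev v -> ev (u + v).
Proof. by move=> [a ->] [b ->]; exists (a + b); rewrite scalerDr. Qed.

Lemma evZ m a (u : 'cV[Z2]_m) : ev u -> ev (a *: u).
Proof. by move=> [b ->]; exists (a *: b); rewrite !scalerA mulrC. Qed.

Lemma evN m (u : 'cV[Z2]_m) : ev u -> ev (- u).
Proof. by rewrite -scaleN1r; exact: evZ. Qed.

Lemma evM m n (X : 'M[Z2]_(m, n)) u : ev u -> ev (X *m u).
Proof. by move=> [b ->]; exists (X *m b); rewrite scalemxAr. Qed.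

Lemma evZ_odd m a (u : 'cV[Z2]_m) : par a -> ev (a *: u) -> ev u.
Proof.
move=> pa /(evZ a^-1); rewrite scalerA mulVr ?scale1r //.
Qed.

Lemma ev_col m n (u : 'cV[Z2]_m) (v : 'cV[Z2]_n) : ev (col_mx u v) <-> ev u /\ ev v.
Proof.
split=> [[w]|[[a ->] [b ->]]]; last by exists (col_mx a b); rewrite scale_col_mx.
rewrite -[w]vsubmxK scale_col_mx => /eq_col_mx[-> ->].
by split; [exists (usubmx w) | exists (dsubmx w)].
Qed.

Lemma prim_row_free m k (X : 'M[Z2]_(m, k)) :
  prim X <-> row_free (map_mx red2 X)^T.
Proof.
split=> [pX|fX c].
  rewrite -kermx_eq0; apply/eqP/row_matrixP => i; rewrite row0.
  set r := row i _; have rX : r *m (map_mx red2 X)^T = 0.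
    by rewrite -row_mul mulmx_ker row0.
  have {pX} /ev_red : ev (map_mx lift2 r)^T.
    apply/pX/ev_red; rewrite map_mxM; apply: trmx_inj.
    rewrite -map_trmx trmx_mul trmxK trmx0 -map_mx_comp.
    by rewrite (map_mx_id lift2K).
  rewrite -map_trmx -map_mx_comp (map_mx_id lift2K) => r0.
  by apply: trmx_inj; rewrite r0 trmx0.
move=> /ev_red; rewrite map_mxM => Xc0; apply/ev_red/trmx_inj.
rewrite trmx0; apply/(row_free_inj fX); rewrite mul0mx -trmx_mul.
by rewrite Xc0 trmx0.
Qed.

Lemma prim_leq m k (X : 'M[Z2]_(m, k)) : prim X -> (k <= m)%N.
Proof. by move=> /prim_row_free /eqP <-; exact: rank_leq_col. Qed.

Lemma unitmx_red n (X : 'M[Z2]_n) : (X \in unitmx) = (map_mx red2 X \in unitmx).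
Proof. by rewrite !unitmxE det_map_mx unitZ2 unitfE red2_eq0 negbK. Qed.

Lemma prim_unitmx n (X : 'M[Z2]_n) : prim X -> X \in unitmx.
Proof. by move=> /prim_row_free; rewrite row_free_unit unitmx_tr -unitmx_red. Qed.

(** Modulo 2, the remaining rows of the Gaussian elimination matrix complete the basis. Any
    entrywise lift of them works, because a determinant is a unit as soon as it is odd. *)
Lemma prim_complete m n (X : 'M[Z2]_(m + n, m)) :
  prim X -> exists Y : 'M_(m + n, n), row_mx X Y \in unitmx.
Proof.
move=> /prim_row_free; set A := (_ ^T) => fA.
have rA : \rank A = m by apply/eqP.
have := mulmx_ebase A; rewrite rA pid_mx_row -[row_ebase A]vsubmxK.
rewrite -mulmxA mul_row_col mul1mx mul0mx addr0 => AE.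
exists (map_mx lift2 (dsubmx (row_ebase A))^T).
rewrite unitmx_red map_row_mx -map_mx_comp (map_mx_id lift2K).
rewrite -unitmx_tr tr_row_mx trmxK -/A -{1}AE.
have -> : col_mx (col_ebase A *m usubmx (row_ebase A)) (dsubmx (row_ebase A)) =
   block_mx (col_ebase A) 0 0 1%:M *m row_ebase A.
  rewrite -{3}[row_ebase A]vsubmxK mul_block_col.
  by rewrite !mul0mx mul1mx addr0 add0r.
rewrite unitmx_mul row_ebase_unit andbT unitmxE det_lblock det1 mulr1.
by rewrite -unitmxE col_ebase_unit.
Qed.

Lemma prim_inv m k (X : 'M[Z2]_(m, k)) (W : 'M_(k, m)) : W *m X = 1%:M -> prim X.
Proof. by move=> WX c /(evM W); rewrite mulmxA WX mul1mx. Qed.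

Lemma prim_mul m k l (X : 'M[Z2]_(m, k)) (Y : 'M_(k, l)) :
  prim X -> prim Y -> prim (X *m Y).
Proof. by move=> pX pY c; rewrite -mulmxA => /pX /pY. Qed.

(** * Isometries and hyperbolic pairs *)

Definition bf m (G : 'M[Z2]_m) (x y : 'cV_m) : Z2 := (x^T *m G *m y) 0 0.

Lemma bfDl m (G : 'M_m) x y z : bf G (x + y) z = bf G x z + bf G y z.
Proof. by rewrite /bf linearD !mulmxDl mxE. Qed.

Lemma bfDr m (G : 'M_m) x y z : bf G x (y + z) = bf G x y + bf G x z.
Proof. by rewrite /bf mulmxDr mxE. Qed.

Lemma bfZl m (G : 'M_m) a x y : bf G (a *: x) y = a * bf G x y.
Proof. by rewrite /bf linearZ -!scalemxAl mxE. Qed.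

Lemma bfZr m (G : 'M_m) a x y : bf G x (a *: y) = a * bf G x y.
Proof. by rewrite /bf -!scalemxAr mxE. Qed.

Lemma bfNl m (G : 'M_m) x y : bf G (- x) y = - bf G x y.
Proof. by rewrite -scaleN1r bfZl mulN1r. Qed.

Lemma bfNr m (G : 'M_m) x y : bf G x (- y) = - bf G x y.
Proof. by rewrite -scaleN1r bfZr mulN1r. Qed.

Lemma bf0l m (G : 'M_m) x : bf G 0 x = 0.
Proof. by rewrite /bf trmx0 !mul0mx mxE. Qed.

Lemma bf0r m (G : 'M_m) x : bf G x 0 = 0.
Proof. by rewrite /bf mulmx0 mxE. Qed.

Definition bfE := (bfDl, bfDr, bfZl, bfZr, bfNl, bfNr, bf0l, bf0r).

Lemma bfC m (G : 'M_m) x y : G^T = G -> bf G x y = bf G y x.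
Proof.
move=> GT; rewrite /bf -[x^T *m G *m y]trmxK [LHS]mxE.
by rewrite !trmx_mul trmxK GT mulmxA.
Qed.

Lemma bf_mulmx m k (G : 'M_m) (X : 'M_(m, k)) c d :
  bf G (X *m c) (X *m d) = bf (X^T *m G *m X) c d.
Proof. by rewrite /bf trmx_mul !mulmxA. Qed.

Lemma bf_scale m (G : 'M_m) a x y : bf (a *: G) x y = a * bf G x y.
Proof. by rewrite /bf -scalemxAr -scalemxAl mxE. Qed.

Lemma bf_ev_l m (G : 'M_m) x y : ev x -> par (bf G x y) = false.
Proof. by move=> [w ->]; rewrite bfZl !parE. Qed.

Definition isom m (G S : 'M_m) : Prop :=
  (forall x y, bf G (S *m x) (S *m y) = bf G x y) /\ prim S.

Lemma isomM m (G S T : 'M_m) : isom G S -> isom G T -> isom G (S *m T).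
Proof.
move=> [SG pS] [TG pT]; split; last exact: prim_mul.
by move=> x y; rewrite -!mulmxA SG TG.
Qed.

Lemma rank1_act m (G : 'M_m) (u v x : 'cV_m) :
  v *m (u^T *m G) *m x = bf G u x *: v.
Proof.
rewrite -mulmxA; apply/matrixP => i j.
by rewrite mxE big_ord1 [RHS]mxE (ord1 j) mulrC.
Qed.

Section Isometries.
Variables (m : nat) (G : 'M[Z2]_m).
Hypothesis GT : G^T = G.

Local Notation B := (bf G).

(** The reflection in v = e - e' does it: Q(v) = -2 B(e, e') with B(e, e') a unit, so the factor 2
    of the reflection formula cancels and [S] is integral. *)
Lemma reflection (e e' : 'cV_m) :
  B e e = 0 -> B e' e' = 0 -> par (B e e') ->
  exists S, isom G S /\ S *m e' = e.
Proof.
move=> Qe Qe' pb; set b := B e e' in pb *.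
have [v vE] : exists v : 'cV[Z2]_m, v = e - e' by exists (e - e').
have b1 : b^-1 * b = 1 by rewrite mulVr.
pose S : 'M[Z2]_m := 1%:M + b^-1 *: (v *m (v^T *m G)).
have Sx x : S *m x = x + (b^-1 * B v x) *: v.
  by rewrite mulmxDl mul1mx -scalemxAl rank1_act scalerA.
have Be'e : B e' e = b by rewrite bfC.
have Qv : B v v = - (b + b) by rewrite vE !bfE Qe Qe' Be'e -/b; ring.
have SS (x : 'cV_m) : S *m (S *m x) = x.
  rewrite !Sx !bfE Qv; apply/matrixP => i j; rewrite !mxE.
  have -> : b^-1 * (B v x + b^-1 * B v x * - (b + b)) =
            b^-1 * B v x - (b^-1 * b) * (b^-1 * B v x) *+ 2 by ring.
  by rewrite b1; ring.
exists S; split; first split.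
- move=> x y; rewrite !Sx !bfE Qv [B x v]bfC //.
  set p := B v x; set q := B v y.
  transitivity (B x y + (b^-1 * p * q) *+ 2 - (b^-1 * b) * (b^-1 * p * q) *+ 2).
    by ring.
  by rewrite b1; ring.
- by move=> c /(evM S); rewrite SS.
- by rewrite Sx vE !bfE Qe' -/b subr0 b1 scale1r addrC subrK.
Qed.

(** The Eichler transformation attached to [e] and [u]; replacing [u] by [-u] inverts it. *)
Lemma eichler (e u : 'cV_m) (h : Z2) :
  B e e = 0 -> B e u = 0 -> B u u = h *+ 2 ->
  exists S, isom G S /\ forall x,
    S *m x = x + B e x *: u - (B u x + h * B e x) *: e.
Proof.
move=> Qe Beu Qu.
have Bue : B u e = 0 by rewrite bfC.
pose S (w : 'cV[Z2]_m) : 'M[Z2]_m := 1%:M + w *m (e^T *m G) - e *m (w^T *m G) - h *: (e *m (e^T *m G)).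
have Sx w x : S w *m x = x + B e x *: w - (B w x + h * B e x) *: e.
  rewrite /S !mulmxBl mulmxDl mul1mx -scalemxAl !rank1_act scalerA scalerDl.
  by rewrite opprD addrA.
exists (S u); split=> [|x]; last exact: Sx.
split=> [x y|c].
  rewrite !Sx !bfE Qe Beu Bue Qu [B x u]bfC // [B x e]bfC //; ring.
move=> /(evM (S (- u))); suff -> : S (- u) *m (S u *m c) = c by [].
rewrite !Sx !bfE Qe Beu Bue Qu; apply/matrixP => i j; rewrite !mxE; ring.
Qed.

Definition hyperbolic (e f : 'cV_m) : Prop := [/\ B e e = 0, B f f = 0 & B e f = 1].

(** One or two reflections move [e'] to [e], the second being needed when B(e, e') is even; it
    passes through an isotropic [g] pairing oddly with both. An Eichler transformation fixing [e]
    then moves the image of [f'] to [f]. *)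
Lemma hyp_isom e f e' f' : hyperbolic e f -> hyperbolic e' f' ->
  exists S, [/\ isom G S, S *m e' = e & S *m f' = f].
Proof.
move=> [Qe Qf Bef] [Qe' Qf' Bef'].
have [S [iS Se']] : exists S, isom G S /\ S *m e' = e.
  case b0: (par (B e e')); first exact: reflection.
  suff [g [Qg pg pg']] : exists g, [/\ B g g = 0, par (B e g) & par (B g e')].
    have [S [iS Sg]] := reflection Qe Qg pg.
    have [T [iT Te']] := reflection Qg Qe' pg'.
    by exists (S *m T); split; [exact: isomM | rewrite -mulmxA Te'].
  case b1: (par (B f e')); first by exists f; rewrite Bef.
  case b2: (par (B e f')); first by exists f'; rewrite (bfC f' e' GT) Bef'.
  pose d := 1 + B e f'; have pd : par d by rewrite /d !parE b2.
  have d1 : d^-1 * d = 1 by rewrite mulVr.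
  have Bfe : B f e = 1 by rewrite bfC.
  have Bfe' : B f' e' = 1 by rewrite bfC.
  (* Here [d] = B(e, f + f') is odd, and the multiple of [e] cancels Q(f + f') = 2 B(f, f'). *)
  exists (f + f' - (d^-1 * B f f') *: e); split.
  - rewrite !bfE Qe Qf Qf' Bef Bfe [B f' f]bfC // [B f' e]bfC //.
    have -> : B e f' = d - 1 by rewrite /d; ring.
    set t := B f f'; transitivity (t *+ 2 - (d^-1 * d) * t *+ 2); first ring.
    by rewrite d1; ring.
  - by rewrite !bfE Qe Bef !parE b2 andbF.
  - by rewrite !bfE Bfe' !parE b0 b1 andbF.
have [f1 f1E] : exists f1 : 'cV[Z2]_m, f1 = S *m f' by eexists.
have [SG _] := iS.
have Qf1 : B f1 f1 = 0 by rewrite f1E SG.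
have Bef1 : B e f1 = 1 by rewrite f1E -Se' SG.
have Bfe : B f e = 1 by rewrite bfC.
have Bf1e : B f1 e = 1 by rewrite bfC.
(* This [u] is orthogonal to [e] with Q(u) = -2 B(f, f1), and its Eichler transformation takes [f1]
   exactly to [f]. *)
have [u uE] : exists u : 'cV[Z2]_m, u = f - f1 - B f f1 *: e by eexists.
have [||T [iT TE]] := @eichler e u (- B f f1) Qe.
- by rewrite uE !bfE Qe Bef Bef1; ring.
- by rewrite uE !bfE Qe Qf Qf1 Bef Bef1 Bfe Bf1e [B f1 f]bfC //; ring.
exists (T *m S); split; first exact: isomM.
  by rewrite -mulmxA Se' TE Qe uE !bfE Qe Bfe Bf1e scale0r; apply/matrixP => i j; rewrite !mxE; ring.
rewrite -mulmxA -f1E TE Bef1 uE !bfE Qf1 Bef1.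
by apply/matrixP => i j; rewrite !mxE; ring.
Qed.

End Isometries.

(** * Orthogonal splittings *)

Definition dsum m n (A : 'M[Z2]_m) (B : 'M[Z2]_n) : 'M_(m + n) := block_mx A 0 0 B.

Lemma dsum_tr m n (A : 'M_m) (B : 'M_n) :
  (dsum A B)^T = dsum A B <-> A^T = A /\ B^T = B.
Proof.
rewrite /dsum tr_block_mx !trmx0; split=> [/eq_block_mx[] //|[-> ->] //].
Qed.

Lemma bf_dsum m n (A : 'M_m) (B : 'M_n) u v u' v' :
  bf (dsum A B) (col_mx u v) (col_mx u' v') = bf A u u' + bf B v v'.
Proof.
rewrite /bf tr_col_mx mul_row_block mul_row_col !mulmx0 addr0 add0r mxE //.
Qed.

Lemma bf_dsumE m n (A : 'M_m) (B : 'M_n) x y :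
  bf (dsum A B) x y = bf A (usubmx x) (usubmx y) + bf B (dsubmx x) (dsubmx y).
Proof. by rewrite -{1}[x]vsubmxK -{1}[y]vsubmxK bf_dsum. Qed.

Definition mk2 (a b c : Z2) : 'M[Z2]_2 :=
  \matrix_(i, j) if i == j then (if i == 0 then a else c) else b.

Definition vec2 (s t : Z2) : 'cV[Z2]_2 := \col_i if i == 0 then s else t.

Lemma I2P (P : 'I_2 -> Prop) : P 0 -> P 1 -> forall i, P i.
Proof.
by move=> P0 P1 [[|[|i]] lti] //; [move: P0 | move: P1]; congr P; apply: val_inj.
Qed.

Lemma lift01 : lift ord0 ord0 = 1 :> 'I_2.
Proof. exact: val_inj. Qed.

Lemma vec2E (v : 'cV[Z2]_2) : v = vec2 (v 0 0) (v 1 0).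
Proof. by apply/matrixP => i j; rewrite (ord1 j) mxE; move: i; apply: I2P. Qed.

Lemma vec2_0 s t : vec2 s t 0 0 = s. Proof. by rewrite mxE. Qed.
Lemma vec2_1 s t : vec2 s t 1 0 = t. Proof. by rewrite mxE. Qed.

Lemma ev_vec2 (v : 'cV[Z2]_2) : ev v <-> par (v 0 0) = false /\ par (v 1 0) = false.
Proof. by split=> [/evP H //|[p0 p1]]; apply/evP; apply: I2P. Qed.

Lemma bf_mk2 a b c u v : bf (mk2 a b c) u v =
  a * (u 0 0 * v 0 0) + b * (u 0 0 * v 1 0 + u 1 0 * v 0 0) + c * (u 1 0 * v 1 0).
Proof.
rewrite /bf mxE !big_ord_recl big_ord0 lift01.
by rewrite !mxE !big_ord_recl !big_ord0 lift01 !mxE /=; ring.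
Qed.

Lemma det_mk2 a b c : \det (mk2 a b c) = a * c - b * b.
Proof.
rewrite (expand_det_row _ 0) !big_ord_recl big_ord0 lift01 /cofactor !det_mx11 !mxE /=.
by ring.
Qed.

Lemma mk2_tr a b c : (mk2 a b c)^T = mk2 a b c.
Proof. by apply/matrixP => i j; rewrite !mxE eq_sym; case: eqP => // ->. Qed.

Lemma det_dsum m n (A : 'M_m) (B : 'M_n) : \det (dsum A B) = \det A * \det B.
Proof. exact: det_ublock. Qed.

Lemma gram_entry m k (G : 'M_m) (X : 'M_(m, k)) i j :
  (X^T *m G *m X) i j = bf G (col i X) (col j X).
Proof.
rewrite /bf tr_col -row_mul [LHS]mxE [RHS]mxE.
by apply: eq_bigr => l _; congr (_ * _); rewrite [RHS]mxE.
Qed.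

Lemma col0_row_mx m (e f : 'cV[Z2]_m) : col (0 : 'I_2) (row_mx e f) = e.
Proof.
rewrite (_ : (0 : 'I_2) = lshift 1 (0 : 'I_1)) ; last exact: val_inj.
apply/matrixP => i j; rewrite [LHS]mxE (ord1 j).
exact: (@row_mxEl Z2 m 1 1 e f).
Qed.
Lemma col1_row_mx m (e f : 'cV[Z2]_m) : col (1 : 'I_2) (row_mx e f) = f.
Proof.
rewrite (_ : (1 : 'I_2) = rshift 1 (0 : 'I_1)) ; last exact: val_inj.
apply/matrixP => i j; rewrite [LHS]mxE (ord1 j).
exact: (@row_mxEr Z2 m 1 1 e f).
Qed.
Lemma gram2 m (G : 'M_m) (e f : 'cV_m) : G^T = G ->
  (row_mx e f)^T *m G *m row_mx e f = mk2 (bf G e e) (bf G e f) (bf G f f).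
Proof.
move=> GT; apply/matrixP => i j; rewrite gram_entry mxE; move: i j.
apply: I2P; apply: I2P; rewrite /= ?col0_row_mx ?col1_row_mx //.
exact: bfC.
Qed.

Lemma mulmx_det_inj m n (A : 'M[Z2]_m) (X Y : 'M_(m, n)) :
  \det A != 0 -> A *m X = A *m Y -> X = Y.
Proof.
move=> dA /(congr1 (mulmx (\adj A))); rewrite !mulmxA mul_adj_mx !mul_scalar_mx.
move=> /matrixP AXY; apply/matrixP => i j; apply: (mulfI dA).
by have := AXY i j; rewrite !mxE.
Qed.

(** The factorization of X^T G through [A] says that orthogonal projection onto the span of [X] has
    integral coordinates [W]. Subtracting the projections from a completing basis makes it
    orthogonal to [X]. *)
Lemma split_dsum m n (G : 'M_(m + n)) (X : 'M_(m + n, m)) (A : 'M_m) (W : 'M_(m, m + n)) :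
  G^T = G -> X^T *m G *m X = A -> X^T *m G = A *m W -> \det A != 0 ->
  exists P N, [/\ P \in unitmx, lsubmx P = X & P^T *m G *m P = dsum A N].
Proof.
move=> GT XGX XG dA.
have WX : W *m X = 1%:M by apply: (mulmx_det_inj dA); rewrite mulmxA -XG XGX mulmx1.
have [Y uY] := prim_complete (prim_inv WX).
pose Y' := Y - X *m W *m Y; exists (row_mx X Y'), (Y'^T *m G *m Y').
have XGY' : X^T *m G *m Y' = 0.
  rewrite mulmxBr XG -!mulmxA [W *m (X *m _)]mulmxA WX mul1mx subrr //.
have Y'GX : Y'^T *m G *m X = 0.
  by apply: trmx_inj; rewrite !trmx_mul trmxK GT mulmxA XGY' trmx0.
split; last 2 first.
- by rewrite row_mxKl.
- by rewrite tr_row_mx mul_col_mx mul_col_row XGX XGY' Y'GX.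
have -> : row_mx X Y' = row_mx X Y *m block_mx 1%:M (- (W *m Y)) 0 1%:M.
  by rewrite mul_row_block !mulmx1 mulmx0 addr0 mulmxN mulmxA addrC.
by rewrite unitmx_mul uY unitmxE det_ublock !det1 mulr1 unitr1.
Qed.

Definition HH : 'M[Z2]_2 := mk2 0 1 0.

Lemma dsum_sym_r m n (G : 'M_(m + n)) P (A : 'M_m) (N : 'M_n) :
  G^T = G -> P^T *m G *m P = dsum A N -> N^T = N.
Proof.
move=> GT PGP; have [] // := (dsum_tr A N).1.
by rewrite -PGP !trmx_mul trmxK GT mulmxA.
Qed.

Lemma split_hyp n (G : 'M_(2 + n)) e f : G^T = G -> hyperbolic G e f ->
  exists P N, [/\ P \in unitmx, N^T = N & P^T *m G *m P = dsum HH N].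
Proof.
move=> GT [Qe Qf Bef].
have [||||P [N [uP _ PGP]]] :=
  @split_dsum 2 n G (row_mx e f) HH (HH *m (row_mx e f)^T *m G) => //.
- by rewrite gram2 // Qe Qf Bef.
- rewrite !mulmxA (_ : HH *m HH = 1%:M) ?mul1mx //.
  apply/matrixP; apply: I2P; apply: I2P;
  by rewrite !mxE !big_ord_recl big_ord0 lift01 !mxE /=; ring.
- by rewrite det_mk2 mul0r sub0r mulr1 oppr_eq0 oner_neq0.
by exists P, N; split => //; apply: dsum_sym_r PGP.
Qed.

(** The vector b^-1 g0 + c x0 has norm 2 (k' + c + 2 h c^2), so its isotropy is a fixed-point
    equation for [c], solved by contraction; dividing by [d] normalizes the pairing. *)
Lemma hyp_complete m (G : 'M_m) x0 g0 h k : G^T = G ->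
  bf G x0 x0 = 4%:R * h -> bf G g0 g0 = 2%:R * k -> par (bf G x0 g0) ->
  exists g, bf G g g = 0 /\ bf G x0 g = 1.
Proof.
move=> GT Qx Qg pb.
pose b := bf G x0 g0; have b1 : b^-1 * b = 1 by rewrite mulVr.
pose k' := k * b^-1 * b^-1.
have [|c cE] := @z2_fixpoint2 (- k') (fun c => - h * (c * c)).
  by move=> j u v uv; rewrite z2seqM [in RHS]z2seqM !(z2seqM u) !(z2seqM v) uv.
pose d := 1 + 4%:R * h * c; have pd : par d by rewrite /d !parE.
have d1 : d^-1 * d = 1 by rewrite mulVr.
exists (d^-1 *: (b^-1 *: g0 + c *: x0)); rewrite !bfE [bf G g0 x0]bfC // Qx Qg -/b; split.
  transitivity (d^-1 * d^-1 * 2%:R * (k' + (b^-1 * b) * c + 2%:R * h * (c * c))).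
    by rewrite /k'; ring.
  rewrite b1 (_ : k' + _ + _ = c - (- k' + - h * (c * c) *+ 2)); last by ring.
  by rewrite -cE subrr mulr0.
transitivity (d^-1 * (b^-1 * b + 4%:R * h * c)); first by ring.
by rewrite b1 d1.
Qed.

(** * Projection that cancels a hyperbolic plane *)

Section Projection.
Variables (n : nat) (N : 'M[Z2]_n).
Hypothesis NT : N^T = N.
Local Notation G := (dsum HH N).

Lemma dsumHH_sym : G^T = G.
Proof. by apply/dsum_tr; rewrite mk2_tr. Qed.

Definition eH : 'cV[Z2]_(2 + n) := col_mx (vec2 1 0) 0.
Definition fH : 'cV[Z2]_(2 + n) := col_mx (vec2 0 1) 0.

Lemma bf_eH x : bf G eH x = usubmx x 1 0.
Proof. by rewrite bf_dsumE col_mxKu col_mxKd bf0l bf_mk2 vec2_0 vec2_1; ring. Qed.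

Lemma bf_fH x : bf G fH x = usubmx x 0 0.
Proof. by rewrite bf_dsumE col_mxKu col_mxKd bf0l bf_mk2 vec2_0 vec2_1; ring. Qed.

Lemma hyp_eHfH : hyperbolic G eH fH.
Proof. by split; rewrite ?bf_eH ?bf_fH col_mxKu ?vec2_0 ?vec2_1. Qed.

(** The passage from the orthogonal complement of [g] to its quotient by [g], identified with [N]:
    an isometry [S] carries the hyperbolic pair (x0 - h g, g) to the standard one. Subtracting B(x0,
    z) g makes z orthogonal to the pair, so [S] sends the result into [N]. *)
Lemma hyp_proj x0 g h :
  bf G x0 x0 = h *+ 2 -> bf G g g = 0 -> bf G x0 g = 1 ->
  exists Pi : 'M_(n, 2 + n),
    (forall z w, bf G z g = 0 -> bf G w g = 0 ->
       bf N (Pi *m z) (Pi *m w) = bf G z w) /\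
    (forall z, bf G z g = 0 -> par (bf G z x0) = false -> ev (Pi *m z) -> ev z).
Proof.
move=> Qx Qg Bxg; have GT := dsumHH_sym.
have Bgx : bf G g x0 = 1 by rewrite bfC.
have hyp' : hyperbolic G (x0 - h *: g) g.
  by split; rewrite ?bfE ?Qx ?Qg ?Bxg ?Bgx //; ring.
have [S [[SG pS] Se Sg]] := hyp_isom GT hyp_eHfH hyp'.
pose Pi := dsubmx S *m (1%:M - g *m (x0^T *m G)).
pose z' z := z - bf G x0 z *: g.
have PiE (z : 'cV_(2 + n)) : Pi *m z = dsubmx (S *m z' z).
  by rewrite -mulmxA mulmxBl mul1mx rank1_act -mul_dsub_mx.
have uz' (z : 'cV_(2 + n)) : bf G z g = 0 -> S *m z' z = col_mx 0 (Pi *m z).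
  move=> Bzg; rewrite PiE -[LHS]vsubmxK; congr col_mx.
  have Bgz : bf G g z = 0 by rewrite bfC.
  rewrite [LHS]vec2E -bf_fH -bf_eH -Se -Sg !SG /z' !bfE Qg Bgz Bxg.
  apply/matrixP => i j; rewrite mxE [RHS]mxE; case: ifP => _; ring.
exists Pi; split=> [z w Bz Bw|z Bz pz].
  have -> : bf N (Pi *m z) (Pi *m w) = bf G (S *m z' z) (S *m z' w).
    by rewrite !uz' // bf_dsum bf0l add0r.
  have Bgw : bf G g w = 0 by rewrite bfC.
  by rewrite SG /z' !bfE Qg Bz Bgw; ring.
move=> ePi; have : ev (S *m z' z) by rewrite uz' //; apply/ev_col; split => //; exists 0; rewrite scaler0.
move=> /pS; rewrite /z' => ez; rewrite -[z](subrK (bf G x0 z *: g)).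
apply: evD => //; have [t ->] : exists t, bf G x0 z = 2%:R * t.
  by apply: z2_half; rewrite bfC.
by exists (t *: g); rewrite scalerA.
Qed.

End Projection.

(** * Splitting off hyperbolic planes from scaled quaternion norm forms *)

Definition nz4 (w : Z2) : Prop := forall y, w <> 4%:R * y.

Lemma nz4_odd w : par w -> nz4 w.
Proof. by move=> pw y wE; move: pw; rewrite wE !parE. Qed.

Lemma nz4_dbl w : par w -> nz4 (2%:R * w).
Proof.
move=> pw y wE; have /z2_dbl_inj wE' : 2%:R * w = 2%:R * (2%:R * y) by rewrite wE; ring.
by move: pw; rewrite wE' !parE.
Qed.

(** What remains of a primitive copy of 2^j K when hyperbolic planes are cancelled: on primitive
    combinations the values have valuation j + 1 or j + 2. *)
Definition good j m k (G : 'M_m) (X : 'M_(m, k)) : Prop :=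
  prim X /\ forall c, ~ ev c ->
    exists w, nz4 w /\ bf G (X *m c) (X *m c) = 2%:R ^+ j.+1 * w.

Lemma bf_par_of_4 m (G : 'M_m) u v : G^T = G ->
  (exists a, bf G u u = 4%:R * a) -> (exists a, bf G v v = 4%:R * a) ->
  (exists a, bf G (u + v) (u + v) = 4%:R * a) -> par (bf G u v) = false.
Proof.
move=> GT [a Qu] [b Qv] [c]; rewrite !bfE Qu Qv [bf G v u]bfC // => Quv.
have /z2_dbl_inj -> : 2%:R * bf G u v = 2%:R * (2%:R * (c - a - b)).
  transitivity (4%:R * a + bf G u v + (bf G u v + 4%:R * b) - 4%:R * a - 4%:R * b).
    by ring.
  by rewrite Quv; ring.
by rewrite !parE.
Qed.

Section Good.
Variables (m k : nat) (j : nat) (G : 'M[Z2]_m) (X : 'M[Z2]_(m, k)).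
Hypotheses (GT : G^T = G) (j_gt0 : (0 < j)%N) (gX : good j G X).

Lemma good4 c : exists a, bf G (X *m c) (X *m c) = 4%:R * a.
Proof.
have [_ vX] := gX; case: (pselect (ev c)) => [[d ->]|/vX[w [_ ->]]].
  by exists (bf G (X *m d) (X *m d)); rewrite -scalemxAr !bfE; ring.
by exists (2%:R ^+ j.-1 * w); rewrite -{1}(prednK j_gt0) !exprS; ring.
Qed.

Lemma good_par c d : par (bf G (X *m c) (X *m d)) = false.
Proof. by apply: bf_par_of_4 => //; rewrite -?mulmxDr; exact: good4. Qed.

End Good.

Lemma good_eqv j m k (G P : 'M_m) (X : 'M_(m, k)) : P \in unitmx ->
  good j G X -> good j (P^T *m G *m P) (invmx P *m X).
Proof.
move=> uP [pX vX]; split=> [c|c /vX].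
  by rewrite -mulmxA => /(evM P); rewrite mulKVmx // => /pX.
by rewrite -bf_mulmx -!mulmxA !mulKVmx.
Qed.

Lemma kernel_basis k (r : 'rV[Z2]_(1 + k)) (c0 : 'cV_(1 + k)) : (r *m c0) 0 0 = 1 ->
  exists P : 'M_(1 + k, k), r *m P = 0 /\ prim P.
Proof.
move=> rc0; have /(@prim_complete 1 k)[Y uM] : prim r^T.
  apply: (@prim_inv _ _ _ c0^T); rewrite -trmx_mul; apply/matrixP => i j.
  by rewrite !ord1 mxE rc0 mxE.
have uM' : col_mx r Y^T \in unitmx by rewrite -unitmx_tr tr_col_mx trmxK.
have := mulmxV uM'; set M := invmx _; rewrite -[M]hsubmxK mul_col_row.
rewrite (scalar_mx_block 1 k (1 : Z2)) => /eq_block_mx[_ rP _ YP].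
by exists (rsubmx M); split=> //; apply: prim_inv YP.
Qed.

(** The image vector at [c0] has norm divisible by 4, so its odd pairing with [g0] produces an
    isotropic [g]. Restricting to coefficients orthogonal to [g] costs one column, and the
    projection stays primitive because B is even on the image of [X]. *)
Lemma good_reduce j n k (N : 'M_n) (X : 'M_(2 + n, 1 + k)) c0 g0 :
  N^T = N -> (0 < j)%N -> good j (dsum HH N) X ->
  par (bf (dsum HH N) g0 g0) = false -> par (bf (dsum HH N) (X *m c0) g0) ->
  exists Y : 'M_(n, k), good j N Y.
Proof.
move=> NT j0 gX /z2_half[l Qg0] pb; have GT := dsumHH_sym NT.
have [h Qx] := good4 j0 gX c0.
have [g [Qg Bg]] := hyp_complete GT Qx Qg0 pb.
have Qx' : bf (dsum HH N) (X *m c0) (X *m c0) = (2%:R * h) *+ 2 by rewrite Qx; ring.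
have [Pi [PiB Piev]] := hyp_proj NT Qx' Qg Bg.
pose r := g^T *m dsum HH N *m X.
have rE c : (r *m c) 0 0 = bf (dsum HH N) (X *m c) g by rewrite bfC // /bf /r !mulmxA.
have [P [rP pP]] := @kernel_basis k r c0 (etrans (rE c0) Bg).
have XPg c : bf (dsum HH N) (X *m (P *m c)) g = 0.
  by rewrite -rE mulmxA rP mul0mx mxE.
have [pX vX] := gX.
exists (Pi *m X *m P); split=> c.
  rewrite -!mulmxA => /Piev ev_imp; apply/pP/pX/ev_imp; first exact: XPg.
  exact: (good_par GT j0 gX).
move=> nc; rewrite -!mulmxA PiB ?XPg //; apply: vX => /pP //.
Qed.

(* No vector in the image of [X] pairs to an odd value with a vector of even norm,
   so no hyperbolic plane meeting the image can be split off. *)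
Definition stuck m k (G : 'M_m) (X : 'M_(m, k)) : Prop :=
  forall c g, par (bf G g g) = false -> par (bf G (X *m c) g) = false.

Lemma good_reduce_or_stuck j n k (N : 'M_n) (X : 'M_(2 + n, 1 + k)) :
  N^T = N -> (0 < j)%N -> good j (dsum HH N) X ->
  (exists Y : 'M_(n, k), good j N Y) \/ stuck (dsum HH N) X.
Proof.
move=> NT j0 gX; case: (pselect (stuck (dsum HH N) X)); first by right.
move=> /existsNP[c /existsNP[g /not_implyP[pg /eqP]]].
by rewrite eqbF_neg negbK => pb; left; apply: (good_reduce NT j0 gX pg pb).
Qed.

Section Stuck.
Variables (n k : nat) (N : 'M[Z2]_n) (X : 'M[Z2]_(2 + n, k)).
Hypotheses (NT : N^T = N) (sX : stuck (dsum HH N) X).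

(** The coordinates along H are pairings with the isotropic vectors [fH] and [eH], hence even.
    Dropping them therefore keeps primitivity and alters norms by multiples of 8. *)
Lemma stuck_usub c : ev (usubmx (X *m c)).
Proof.
have GT := dsumHH_sym NT; have [Qe Qf _] := hyp_eHfH N.
apply/ev_vec2; split.
  by rewrite -(bf_fH N) bfC //; apply: sX; rewrite Qf.
by rewrite -(bf_eH N) bfC //; apply: sX; rewrite Qe.
Qed.

Lemma stuck_dsub_prim : prim X -> prim (dsubmx X).
Proof.
move=> pX c; rewrite mul_dsub_mx => ed; apply: pX.
by rewrite -[X *m c]vsubmxK; apply/ev_col; split=> //; exact: stuck_usub.
Qed.

Lemma stuck_dsub : stuck N (dsubmx X).
Proof.
move=> c g pg; have := sX c (g := col_mx 0 g).
rewrite !bf_dsumE !col_mxKu !col_mxKd !bf0r add0r -mul_dsub_mx.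
by rewrite add0r; apply.
Qed.

Lemma stuck_value c : exists a,
  bf (dsum HH N) (X *m c) (X *m c) =
  bf N (dsubmx X *m c) (dsubmx X *m c) + 8%:R * a.
Proof.
have [u uE] := stuck_usub c; exists (u 0 0 * u 1 0).
by rewrite bf_dsumE uE bf_mk2 !mxE mul_dsub_mx; ring.
Qed.

End Stuck.

(** * Vectors of even norm and the form Q/2 modulo 2 *)

Definition even_lattice m (N : 'M_m) : Prop := forall v, par (bf N v v) = false.

Lemma even_of_prim m (N T : 'M_m) : prim T ->
  (forall c, par (bf N (T *m c) (T *m c)) = false) -> even_lattice N.
Proof. by move=> /prim_unitmx uT H v; rewrite -[v](mulKVmx uT). Qed.

(* The even vectors of [N] modulo 2 form a totally singular space for [Q/2]. *)
Definition singular_even m (N : 'M_m) : Prop :=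
  forall v, par (bf N v v) = false -> exists w, bf N v v = 4%:R * w.

Lemma row_mx_col1 m k (T : 'M[Z2]_(m, k)) (o : 'cV_m) (c : 'cV_(k + 1)) :
  row_mx T o *m c = T *m usubmx c + dsubmx c 0 0 *: o.
Proof.
rewrite -{1}[c]vsubmxK mul_row_col; congr (_ + _).
by apply/matrixP => i j; rewrite mxE big_ord1 [RHS]mxE (ord1 j) mulrC.
Qed.

Lemma prim_row_mx m k (T : 'M[Z2]_(m, k)) (o : 'cV_m) : prim T ->
  (forall c a, ev (T *m c + a *: o) -> par a = false) -> prim (row_mx T o).
Proof.
move=> pT H c; rewrite row_mx_col1 => ec; have pa := H _ _ ec.
rewrite -[c]vsubmxK; apply/ev_col; split.
  apply: pT; rewrite -[T *m _](addrK (dsubmx c 0 0 *: o)).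
  by have [b bE] := z2_half pa; apply: evD => //; rewrite bE -scalerA; exact/evN/ev_dbl.
by apply/evP => i; rewrite (ord1 i).
Qed.

Lemma parQD m (G : 'M[Z2]_m) x y : G^T = G ->
  par (bf G (x + y) (x + y)) = par (bf G x x) (+) par (bf G y y).
Proof.
move=> GT; rewrite !bfE [bf G y x]bfC // !parE.
by case: (par (bf G x x)); case: (par (bf G x y)); case: (par _).
Qed.

Lemma parQZ m (G : 'M[Z2]_m) a x : par (bf G (a *: x) (a *: x)) = par a && par (bf G x x).
Proof. by rewrite !bfE !parE; case: (par a). Qed.

(** The columns of [T] together with [o] form a basis, and the parity of a norm is that of the
    coefficient on [o]. *)
Lemma singular_even_of_span k (N : 'M_(k + 1)) (T : 'M_(k + 1, k)) o :
  N^T = N -> prim T -> par (bf N o o) ->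
  (forall c, exists a, bf N (T *m c) (T *m c) = 4%:R * a) -> singular_even N.
Proof.
move=> NT pT po QT.
have odd_coef c a : par (bf N (T *m c + a *: o) (T *m c + a *: o)) = par a.
  by rewrite parQD // parQZ po andbT; have [d ->] := QT c; rewrite !parE.
have pR : prim (row_mx T o).
  by apply: prim_row_mx => // c a ec; rewrite -(odd_coef c) (bf_ev_l N _ ec).
move=> v; have [c ->] : exists c, v = row_mx T o *m c.
  by exists (invmx (row_mx T o) *m v); rewrite mulKVmx ?prim_unitmx.
rewrite row_mx_col1; set a := dsubmx c 0 0; set d := usubmx c; rewrite odd_coef.
move=> /z2_half[b ->]; have [w Qw] := QT d.
exists (w + b * bf N (T *m d) o + b * b * bf N o o).
by rewrite !bfE Qw [bf N o (T *m d)]bfC //; ring.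
Qed.

(** Such [u] and [v] would span a plane of Arf invariant 1 for Q/2 modulo 2. But [N] contributes
    nothing to Q/2 modulo 2, and in H only the residue (1, 1) has odd Q/2; so both have this residue
    and B(u, v) is even. *)
Lemma singular_even_arf n (N : 'M_n) u v a b : N^T = N -> singular_even N ->
  bf (dsum HH N) u u = 2%:R * a -> bf (dsum HH N) v v = 2%:R * b ->
  par a -> par b -> par (bf (dsum HH N) u v) -> False.
Proof.
move=> NT ZN; rewrite !bf_dsumE !bf_mk2.
set s := dsubmx u; set t := dsubmx v.
set u0 := usubmx u 0 0; set u1 := usubmx u 1 0.
set v0 := usubmx v 0 0; set v1 := usubmx v 1 0 => Qu Qv pa pb.
have half (x y d c : Z2) : 0 * (x * x) + 1 * (x * y + y * x) + 0 * (y * y) + d = 2%:R * c ->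
    par d = false.
  by move=> /(congr1 par); rewrite !parE /=; case: (par x); case: (par y); case: (par d).
have [ws Qs] := ZN s (half _ _ _ _ Qu); have [wt Qt] := ZN t (half _ _ _ _ Qv).
have st : par (bf N s t) = false.
  apply: bf_par_of_4; [by []|by exists ws|by exists wt|apply: ZN].
  by rewrite !bfE Qs Qt [bf N t s]bfC // !parE /=; case: (par _).
have odd2 (x y d c : Z2) : 0 * (x * x) + 1 * (x * y + y * x) + 0 * (y * y) + 4%:R * d = 2%:R * c ->
    par c -> par x && par y.
  move=> E pc; have /z2_dbl_inj cE : 2%:R * c = 2%:R * (x * y + 2%:R * d).
    by rewrite -E; ring.
  by move: pc; rewrite cE !parE addbF.
rewrite Qs in Qu; rewrite Qt in Qv.
have /andP[pu0 pu1] := odd2 _ _ _ _ Qu pa; have /andP[pv0 pv1] := odd2 _ _ _ _ Qv pb.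
by rewrite !parE pu0 pu1 pv0 pv1 st.
Qed.

(** * Differences of ramified binary forms *)

Lemma eq_of_scaled_sub (c a b u v : Z2) : c != 0 -> a = b -> c * (u - v) = a - b -> u = v.
Proof.
move=> c0 -> /eqP; rewrite subrr mulf_eq0 (negPf c0) subr_eq0 => /eqP //.
Qed.

Lemma pow2_neq0 n : (2%:R ^+ n : Z2) != 0.
Proof. by rewrite expf_neq0 // z2_2neq0. Qed.

Lemma z2_4neq0 : (4%:R : Z2) != 0.
Proof.
have -> : 4%:R = 2%:R * 2%:R :> Z2 by ring.
by rewrite mulf_neq0 ?z2_2neq0.
Qed.

Lemma sq_odd8 (u : Z2) : par u -> exists y, u * u = 1 + 8%:R * y.
Proof.
case/par_odd=> a ->; have [|b bE] := @z2_half (a * (a + 1)).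
  by rewrite !parE; case: (par a).
exists b; transitivity (1 + 4%:R * (a * (a + 1))); first by ring.
by rewrite bE; ring.
Qed.

Lemma sq_sub8 (u v : Z2) : par u -> par v -> exists y, u * u - v * v = 8%:R * y.
Proof.
by move=> /sq_odd8[a ->] /sq_odd8[b ->]; exists (a - b); ring.
Qed.

Lemma sq_sub4 (u v : Z2) : par u = par v -> exists y, u * u - v * v = 4%:R * y.
Proof.
move=> uv; have [|a aE] := @z2_half (u - v); first by rewrite !parE uv addbb.
have -> : u = v + 2%:R * a by rewrite -aE; ring.
by exists (a * (a + v)); ring.
Qed.

Section Binary.
Variables (d e k : Z2).
Hypotheses (pd : par d) (pe : par e).

(** Up to the unit [d], the norm of z + y pi, where pi is a root of the Eisenstein polynomial t^2 -
    (2k/d) t + 2e/d. *)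
Definition qD (z y : Z2) : Z2 := d * z * z + 2%:R * k * z * y + 2%:R * e * y * y.

(** Descent: parity forces [z] and then [y] to be even, and 4 can be divided out. *)
Lemma qD_dvd_odd p z y x : qD z y = 2%:R * (2%:R ^+ p * 2%:R ^+ p) * x ->
  exists z' y', z = 2%:R ^+ p * (2%:R * z') /\ y = 2%:R ^+ p * y'.
Proof.
rewrite /qD; elim: p z y => [|p IH] z y E; have [|z1 zE] := @z2_half z.
- by have := congr1 par E; rewrite !parE /= pd; case: (par z).
- by exists z1, y; rewrite zE expr0 !mul1r.
- by have := congr1 par E; rewrite !parE /= pd; case: (par z).
have [|y1 yE] := @z2_half y.
  have {}E : e * y * y =
      2%:R * (2%:R * (2%:R ^+ p * 2%:R ^+ p) * x - d * z1 * z1 - k * z1 * y).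
    by apply: (eq_of_scaled_sub z2_2neq0 E); rewrite zE !exprS; ring.
  by have := congr1 par E; rewrite !parE /= pe; case: (par y).
have [|z' [y' [z1E y1E]]] := IH z1 y1.
  by apply: (eq_of_scaled_sub (pow2_neq0 2) E); rewrite zE yE !exprS; ring.
by exists z', y'; rewrite zE yE z1E y1E !exprS; split; ring.
Qed.

Lemma qD_dvd_even p z y x : qD z y = 2%:R ^+ p * 2%:R ^+ p * x ->
  exists z' y', z = 2%:R ^+ p * z' /\ y = 2%:R ^+ p * y'.
Proof.
case: p => [|p]; first by exists z, y; rewrite expr0 !mul1r.
rewrite /qD => E.
have [|z' [y' [zE yE]]] := @qD_dvd_odd p z y (2%:R * x).
  by rewrite /qD E !exprS; ring.
have [|y1 y1E] := @z2_half y'.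
  have {}E : e * y' * y' = 2%:R * (x - d * z' * z' - k * z' * y').
    by apply: (eq_of_scaled_sub (pow2_neq0 p.*2.+1) E); rewrite zE yE !exprS -addnn exprD; ring.
  by have := congr1 par E; rewrite !parE /= pe; case: (par y').
by exists z', y1; rewrite zE yE y1E !exprS; split; ring.
Qed.

Lemma nz4_cross (wa wb wc : Z2) : nz4 wa -> nz4 (wa + 2%:R * wc + 4%:R * wb) ->
  par wa = false -> par wc -> False.
Proof.
move=> na nc /z2_half[a aE] /par_odd[c cE].
case pa: (par a); last by have [b bE] := z2_half pa; apply: (na b); rewrite aE bE; ring.
have [b bE] := par_odd pa; apply: (nc (b + 1 + c + wb)).
by rewrite aE bE cE; ring.
Qed.

Lemma pow2_mul_odd r (b w : Z2) : b = 2%:R ^+ r * w -> par b -> r = 0%N /\ par w.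
Proof.
move=> ->; rewrite parM parX par2 /=; case: r => //=.
Qed.

(* [(xa, ya), (xb, yb)] and [(za, ta), (zb, tb)] are the images of a basis under two
   maps into [(Z2^2, qD)], whose pullbacks of [qD] differ by [M] times a form without
   values divisible by 4 at primitive vectors. *)
Definition diff4 (M xa ya xb yb za ta zb tb : Z2) : Prop :=
  forall s t : Z2, par s || par t -> exists w, nz4 w /\
    qD (s * xa + t * xb) (s * ya + t * yb) - qD (s * za + t * zb) (s * ta + t * tb) =
    M * w.

(** The coefficients of the quotient form are read off at (1, 0), (0, 1) and (1, 1); the third
    condition is its value at (1, 2), the one that [nz4_cross] refutes. *)
Lemma diff4E M xa ya xb yb za ta zb tb : M != 0 ->
  diff4 M xa ya xb yb za ta zb tb -> exists wa wb wc,
  [/\ nz4 wa, nz4 wb, nz4 (wa + 2%:R * wc + 4%:R * wb) &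
  [/\ qD xa ya - qD za ta = M * wa, qD xb yb - qD zb tb = M * wb &
     2%:R * (d * (xa * xb - za * zb) + k * (xa * yb + xb * ya - za * tb - zb * ta)
       + 2%:R * e * (ya * yb - ta * tb)) = M * wc]].
Proof.
move=> M0 H.
have [|wa [na Ea]] := H 1 0; first by rewrite par1.
have [|wb [nb Eb]] := H 0 1; first by rewrite par1 orbT.
have [|w1 [_ E1]] := H 1 1; first by rewrite par1.
have [|w2 [n2 E2]] := H 1 2%:R; first by rewrite par1.
have {}Ea : qD xa ya - qD za ta = M * wa by rewrite -Ea /qD; ring.
have {}Eb : qD xb yb - qD zb tb = M * wb by rewrite -Eb /qD; ring.
exists wa, wb, (w1 - wa - wb); split => //; last first.
  split; [exact: Ea | exact: Eb |].
  transitivity (M * w1 - M * wa - M * wb); last by ring.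
  by rewrite -Ea -Eb -E1 /qD; ring.
suff <- : w2 = wa + 2%:R * (w1 - wa - wb) + 4%:R * wb by [].
apply: (mulfI M0); rewrite -E2.
transitivity (2%:R * (M * w1) + 2%:R * (M * wb) - M * wa); last by ring.
by rewrite -Ea -Eb -E1 /qD; ring.
Qed.

Section Cores.
Variables (q r : nat) (X Y U V : Z2).
Hypotheses (pU : par U) (pV : par V).
Variables (xa ya xb yb : Z2).
Local Notation A := (2%:R ^+ q : Z2).
Local Notation R := (2%:R ^+ r : Z2).

(** The second map takes values of valuations 2q + 1 and 2(q + r + 1) on the basis, and the scale
    has one more than the larger. Divisibility gives the first map the same shape. Odd squares agree
    modulo 8, so [x] and [X] agree modulo 2, and [y] and [Y] must differ, or else 4 divides [wb].
    The cross term is then odd, whence r = 0 and [wc] is odd; but [wa] is even, against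
    [nz4_cross]. *)
Lemma core_split_even : k = 0 ->
  let P := 2%:R * A * R in
  ~ diff4 (2%:R * P * P) xa ya xb yb (2%:R * A * X) (A * V) (P * U) (P * Y).
Proof.
move=> k0 P /diff4E[|wa [wb [wc [na nb nc [Ea Eb Ec]]]]].
  by rewrite !mulf_neq0 ?pow2_neq0 ?z2_2neq0.
have PE : P = 2%:R ^+ (q + r).+1 by rewrite /P exprS exprD; ring.
have [|x [u [xaE yaE]]] := @qD_dvd_odd q xa ya
   (2%:R * d * X * X + e * V * V + 4%:R * R * R * wa).
  by apply: (eq_of_scaled_sub (oner_neq0 Z2) Ea); rewrite /qD k0 /P; ring.
have [|z [y [xbE ybE]]] := @qD_dvd_even (q + r).+1 xb yb
   (d * U * U + 2%:R * e * Y * Y + 2%:R * wb).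
  by rewrite -PE; apply: (eq_of_scaled_sub (oner_neq0 Z2) Eb); rewrite /qD k0; ring.
rewrite -PE in xbE ybE.
have A0 := pow2_neq0 q; have R0 := pow2_neq0 r.
have P0 : P != 0 by rewrite PE pow2_neq0.
have {}Ea : e * (u * u - V * V) = 2%:R * (2%:R * R * R * wa - d * (x * x - X * X)).
  apply: (eq_of_scaled_sub _ Ea); first exact: (mulf_neq0 z2_2neq0 (mulf_neq0 A0 A0)).
  by rewrite xaE yaE /qD k0 /P; ring.
have {}Eb : d * (z * z - U * U) + 2%:R * e * (y * y - Y * Y) = 2%:R * wb.
  apply: (eq_of_scaled_sub _ Eb); first exact: (mulf_neq0 P0 P0).
  by rewrite xbE ybE /qD k0; ring.
have {}Ec : d * (x * z - X * U) + e * (u * y - V * Y) = R * wc.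
  apply: (eq_of_scaled_sub _ Ec); first exact: (mulf_neq0 (pow2_neq0 2) (mulf_neq0 A0 P0)).
  by rewrite xbE ybE xaE yaE k0 /P; ring.
have pu : par u by have := congr1 par Ea; rewrite !parE pe pV; case: (par u).
have pz : par z by have := congr1 par Eb; rewrite !parE pd pU; case: (par z).
have [f fE] := sq_sub8 pu pV; have [g gE] := sq_sub8 pz pU.
have xX : par x = par X.
  have /(congr1 par) : d * (x * x - X * X) = 2%:R * (R * R * wa - 2%:R * e * f).
    by apply: (eq_of_scaled_sub z2_2neq0 Ea); rewrite fE; ring.
  by rewrite !parE pd; case: (par x); case: (par X).
have yY : par y (+) par Y.
  apply: contraT => /negPf yY; have {}yY : par y = par Y.
    by move: yY; case: (par y); case: (par Y).
  have [h hE] := sq_sub4 yY; case: (nb (d * g + e * h)).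
  by apply: (eq_of_scaled_sub z2_2neq0 (esym Eb)); rewrite gE hE; ring.
have [r0 pwc] : r = 0%N /\ par wc.
  apply: (pow2_mul_odd Ec); rewrite !parE pd pe pz pU pu pV xX addbb /=.
  by move: yY; case: (par y); case: (par Y).
apply: (nz4_cross na nc _ pwc).
have [h hE] := sq_sub4 xX.
have -> : wa = 2%:R * (d * h + e * f).
  apply: (eq_of_scaled_sub (pow2_neq0 2) (esym Ea)); rewrite fE hE r0; ring.
by rewrite !parE.
Qed.

(** The same argument with the coordinates interchanged: the smaller valuation is now 2q and the
    larger 2(q + r) + 1. *)
Lemma core_split_odd : k = 0 ->
  let P := A * R in
  ~ diff4 (4%:R * P * P) xa ya xb yb (A * V) (A * Y) (2%:R * P * X) (P * U).
Proof.
move=> k0 P /diff4E[|wa [wb [wc [na nb nc [Ea Eb Ec]]]]].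
  by rewrite !mulf_neq0 ?z2_4neq0 ?pow2_neq0.
have PE : P = 2%:R ^+ (q + r) by rewrite /P exprD.
have [|u [y [xaE yaE]]] := @qD_dvd_even q xa ya
   (d * V * V + 2%:R * e * Y * Y + 4%:R * R * R * wa).
  by apply: (eq_of_scaled_sub (oner_neq0 Z2) Ea); rewrite /qD k0 /P; ring.
have [|x [z [xbE ybE]]] := @qD_dvd_odd (q + r) xb yb
   (2%:R * d * X * X + e * U * U + 2%:R * wb).
  by rewrite -PE; apply: (eq_of_scaled_sub (oner_neq0 Z2) Eb); rewrite /qD k0; ring.
rewrite -PE in xbE ybE.
have A0 := pow2_neq0 q; have R0 := pow2_neq0 r.
have P0 : P != 0 by rewrite PE pow2_neq0.
have {}Ea : d * (u * u - V * V) = 2%:R * (2%:R * R * R * wa - e * (y * y - Y * Y)).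
  apply: (eq_of_scaled_sub _ Ea); first exact: (mulf_neq0 A0 A0).
  by rewrite xaE yaE /qD k0 /P; ring.
have {}Eb : 2%:R * d * (x * x - X * X) + e * (z * z - U * U) = 2%:R * wb.
  apply: (eq_of_scaled_sub _ Eb); first exact: (mulf_neq0 z2_2neq0 (mulf_neq0 P0 P0)).
  by rewrite xbE ybE /qD k0; ring.
have {}Ec : d * (x * u - X * V) + e * (z * y - U * Y) = R * wc.
  apply: (eq_of_scaled_sub _ Ec); first exact: (mulf_neq0 (pow2_neq0 2) (mulf_neq0 A0 P0)).
  by rewrite xbE ybE xaE yaE k0 /P; ring.
have pu : par u by have := congr1 par Ea; rewrite !parE pd pV; case: (par u).
have pz : par z by have := congr1 par Eb; rewrite !parE pe pU; case: (par z).
have [f fE] := sq_sub8 pu pV; have [g gE] := sq_sub8 pz pU.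
have yY : par y = par Y.
  have /(congr1 par) : e * (y * y - Y * Y) = 2%:R * (R * R * wa - 2%:R * d * f).
    by apply: (eq_of_scaled_sub z2_2neq0 Ea); rewrite fE; ring.
  by rewrite !parE pe; case: (par y); case: (par Y).
have xX : par x (+) par X.
  apply: contraT => /negPf xX; have {}xX : par x = par X.
    by move: xX; case: (par x); case: (par X).
  have [h hE] := sq_sub4 xX; case: (nb (d * h + e * g)).
  by apply: (eq_of_scaled_sub z2_2neq0 (esym Eb)); rewrite gE hE; ring.
have [r0 pwc] : r = 0%N /\ par wc.
  apply: (pow2_mul_odd Ec); rewrite !parE pd pe pz pU pu pV yY addbb /=.
  by move: xX; case: (par x); case: (par X).
apply: (nz4_cross na nc _ pwc).
have [h hE] := sq_sub4 yY.
have -> : wa = 2%:R * (d * f + e * h).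
  apply: (eq_of_scaled_sub (pow2_neq0 2) (esym Ea)); rewrite fE hE r0; ring.
by rewrite !parE.
Qed.

(** For odd [k] the scale has the valuation of the larger value itself. An odd [z] would make [wb]
    divisible by 4, as the terms in [k] and [e] have equal parity; so [z] is even and k (z u - U V)
    makes the cross term odd. *)
Lemma core_unimod_even : par k ->
  let P := 2%:R * A * R in
  ~ diff4 (P * P) xa ya xb yb (2%:R * A * X) (A * V) (P * U) (P * Y).
Proof.
move=> pk P /diff4E[|wa [wb [wc [na nb nc [Ea Eb Ec]]]]].
  by rewrite !mulf_neq0 ?pow2_neq0 ?z2_2neq0.
have PE : P = 2%:R ^+ (q + r).+1 by rewrite /P exprS exprD; ring.
have [|x [u [xaE yaE]]] := @qD_dvd_odd q xa ya
   (2%:R * d * X * X + 2%:R * k * X * V + e * V * V + 2%:R * R * R * wa).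
  by apply: (eq_of_scaled_sub (oner_neq0 Z2) Ea); rewrite /qD /P; ring.
have [|z [y [xbE ybE]]] := @qD_dvd_even (q + r).+1 xb yb
   (d * U * U + 2%:R * k * U * Y + 2%:R * e * Y * Y + wb).
  by rewrite -PE; apply: (eq_of_scaled_sub (oner_neq0 Z2) Eb); rewrite /qD; ring.
rewrite -PE in xbE ybE.
have A0 := pow2_neq0 q; have R0 := pow2_neq0 r.
have P0 : P != 0 by rewrite PE pow2_neq0.
have {}Ea : e * (u * u - V * V) =
    2%:R * (R * R * wa - d * (x * x - X * X) - k * (x * u - X * V)).
  apply: (eq_of_scaled_sub _ Ea); first exact: (mulf_neq0 z2_2neq0 (mulf_neq0 A0 A0)).
  by rewrite xaE yaE /qD /P; ring.
have {}Eb : wb = d * (z * z - U * U) + 2%:R * (k * (z * y - U * Y) + e * (y * y - Y * Y)).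
  apply: (eq_of_scaled_sub _ (esym Eb)); first exact: (mulf_neq0 P0 P0).
  by rewrite xbE ybE /qD; ring.
have {}Ec : 2%:R * (d * (x * z - X * U) + k * (x * y - X * Y) + e * (u * y - V * Y))
    + k * (z * u - U * V) = R * wc.
  apply: (eq_of_scaled_sub _ Ec); first exact: (mulf_neq0 z2_2neq0 (mulf_neq0 A0 P0)).
  by rewrite xbE ybE xaE yaE /P; ring.
have pu : par u by have := congr1 par Ea; rewrite !parE pe pV; case: (par u).
have [f fE] := sq_sub8 pu pV.
have pz : par z = false.
  apply/negP => pz; have [g gE] := sq_sub8 pz pU.
  have [|h hE] := @z2_half (k * (z * y - U * Y) + e * (y * y - Y * Y)).
    by rewrite !parE pk pe pz pU; case: (par y); case: (par Y).
  by case: (nb (2%:R * d * g + h)); rewrite Eb gE hE; ring.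
have [r0 pwc] : r = 0%N /\ par wc.
  by apply: (pow2_mul_odd Ec); rewrite !parE pk pz pU pV.
apply: (nz4_cross na nc _ pwc).
have -> : wa = d * (x * x - X * X) + k * (x * u - X * V) + 4%:R * e * f.
  by apply: (eq_of_scaled_sub z2_2neq0 (esym Ea)); rewrite fE r0; ring.
by rewrite !parE pd pk pu pV; case: (par x); case: (par X).
Qed.

Lemma core_unimod_odd : par k ->
  let P := A * R in
  ~ diff4 (2%:R * P * P) xa ya xb yb (A * V) (A * Y) (2%:R * P * X) (P * U).
Proof.
move=> pk P /diff4E[|wa [wb [wc [na nb nc [Ea Eb Ec]]]]].
  by rewrite !mulf_neq0 ?pow2_neq0 ?z2_2neq0.
have PE : P = 2%:R ^+ (q + r) by rewrite /P exprD.
have [|u [y [xaE yaE]]] := @qD_dvd_even q xa ya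
   (d * V * V + 2%:R * k * V * Y + 2%:R * e * Y * Y + 2%:R * R * R * wa).
  by apply: (eq_of_scaled_sub (oner_neq0 Z2) Ea); rewrite /qD /P; ring.
have [|x [z [xbE ybE]]] := @qD_dvd_odd (q + r) xb yb
   (2%:R * d * X * X + 2%:R * k * X * U + e * U * U + wb).
  by rewrite -PE; apply: (eq_of_scaled_sub (oner_neq0 Z2) Eb); rewrite /qD; ring.
rewrite -PE in xbE ybE.
have A0 := pow2_neq0 q; have R0 := pow2_neq0 r.
have P0 : P != 0 by rewrite PE pow2_neq0.
have {}Ea : d * (u * u - V * V) =
    2%:R * (R * R * wa - k * (u * y - V * Y) - e * (y * y - Y * Y)).
  apply: (eq_of_scaled_sub _ Ea); first exact: (mulf_neq0 A0 A0).
  by rewrite xaE yaE /qD /P; ring.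
have {}Eb : wb = 2%:R * (d * (x * x - X * X) + k * (x * z - X * U)) + e * (z * z - U * U).
  apply: (eq_of_scaled_sub _ (esym Eb)); first exact: (mulf_neq0 z2_2neq0 (mulf_neq0 P0 P0)).
  by rewrite xbE ybE /qD; ring.
have {}Ec : 2%:R * (d * (x * u - X * V) + k * (x * y - X * Y) + e * (z * y - U * Y))
    + k * (u * z - V * U) = R * wc.
  apply: (eq_of_scaled_sub _ Ec); first exact: (mulf_neq0 z2_2neq0 (mulf_neq0 A0 P0)).
  by rewrite xbE ybE xaE yaE /P; ring.
have pu : par u by have := congr1 par Ea; rewrite !parE pd pV; case: (par u).
have [f fE] := sq_sub8 pu pV.
have pz : par z = false.
  apply/negP => pz; have [g gE] := sq_sub8 pz pU.
  have [|h hE] := @z2_half (d * (x * x - X * X) + k * (x * z - X * U)).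
    by rewrite !parE pk pd pz pU; case: (par x); case: (par X).
  by case: (nb (h + 2%:R * e * g)); rewrite Eb gE hE; ring.
have [r0 pwc] : r = 0%N /\ par wc.
  by apply: (pow2_mul_odd Ec); rewrite !parE pk pz pU pV andbF.
apply: (nz4_cross na nc _ pwc).
have -> : wa = k * (u * y - V * Y) + e * (y * y - Y * Y) + 4%:R * d * f.
  by apply: (eq_of_scaled_sub z2_2neq0 (esym Ea)); rewrite fE r0; ring.
by rewrite !parE pe pk pu pV; case: (par y); case: (par Y).
Qed.

End Cores.
End Binary.

(** * Normal bases for maps into a ramified plane *)

Lemma z2_dvd_total (x y : Z2) : (exists c, x = c * y) \/ (exists c, y = c * x).
Proof.
have [->|/z2_decomp[i [u [pu xE]]]] := eqVneq x 0; first by left; exists 0; rewrite mul0r.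
have [->|/z2_decomp[j [v [pv yE]]]] := eqVneq y 0; first by right; exists 0; rewrite mul0r.
have uu : u^-1 * u = 1 by rewrite mulVr.
have vv : v^-1 * v = 1 by rewrite mulVr.
case: (leqP i j) => [ij|/ltnW ij]; [right|left].
  exists (2%:R ^+ (j - i) * v * u^-1); rewrite xE yE.
  transitivity (2%:R ^+ (j - i) * 2%:R ^+ i * v * (u^-1 * u)); last by ring.
  by rewrite uu mulr1 -exprD subnK.
exists (2%:R ^+ (i - j) * u * v^-1); rewrite xE yE.
transitivity (2%:R ^+ (i - j) * 2%:R ^+ j * u * (v^-1 * v)); last by ring.
by rewrite vv mulr1 -exprD subnK.
Qed.

Lemma parV (u : Z2) : par u -> par u^-1.
Proof.
move=> pu; have uu : u^-1 * u = 1 by rewrite mulVr.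
by have := congr1 par uu; rewrite !parE => /andP[].
Qed.

Lemma pow2_dvd_odd i j (u x : Z2) : par u -> 2%:R ^+ i * u = 2%:R ^+ j * x -> (j <= i)%N.
Proof.
move=> pu E; rewrite leqNgt; apply/negP => ij.
have uE : u = 2%:R * (2%:R ^+ (j - i.+1) * x).
  apply: (mulfI (pow2_neq0 i)); rewrite E.
  have -> : j = (i + (j - i.+1)).+1 by lia.
  rewrite -addSn addKn addSn exprS exprD; ring.
by move: pu; rewrite uE !parE.
Qed.

(* The valuation of [d z^2 + 2 k z y + 2 e y^2] is the minimum of [2 v(z)] and
   [2 v(y) + 1]; a basis of Z2^2 has normal form for a map into this plane when
   its two images have values of different parity, the first being smaller. *)
Definition normal_basis (za ya zb yb : Z2) : Prop :=
  exists q r X Y U V, [/\ par U, par V &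
    [/\ za = 2%:R * 2%:R ^+ q * X, ya = 2%:R ^+ q * V,
        zb = 2%:R * 2%:R ^+ q * 2%:R ^+ r * U & yb = 2%:R * 2%:R ^+ q * 2%:R ^+ r * Y] \/
    [/\ za = 2%:R ^+ q * V, ya = 2%:R ^+ q * Y,
        zb = 2%:R * (2%:R ^+ q * 2%:R ^+ r) * X & yb = 2%:R ^+ q * 2%:R ^+ r * U]].

Definition has_normal_basis (z1 y1 z2 y2 : Z2) : Prop :=
  exists a1 a2 b1 b2 : Z2, par (a1 * b2 - a2 * b1) /\
    normal_basis (a1 * z1 + a2 * z2) (a1 * y1 + a2 * y2)
                 (b1 * z1 + b2 * z2) (b1 * y1 + b2 * y2).

(** Compare the valuations k of [y1], i of [z2] and l of [y2]. If [y1] divides [y2], clear [y2] and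
    order the basis by k and i. Otherwise the second vector comes first, led by [z2] or by [y2], and
    in the latter case [y1] is cleared. *)
Lemma has_normal_basis0 (y1 z2 y2 : Z2) : y1 != 0 -> z2 != 0 -> has_normal_basis 0 y1 z2 y2.
Proof.
move=> /z2_decomp[k [u' [pu' y1E]]] /z2_decomp[i [u [pu z2E]]].
have uu' : u'^-1 * u' = 1 by rewrite mulVr.
have [[c y2E]|[l [w [pw y2E lk]]]] : (exists c, y2 = 2%:R ^+ k * c) \/
    exists l w, [/\ par w, y2 = 2%:R ^+ l * w & (l < k)%N].
- have [->|/z2_decomp[l [w [pw y2E]]]] := eqVneq y2 0; first by left; exists 0; rewrite mulr0.
  case: (leqP k l) => kl; last by right; exists l, w.
  by left; exists (2%:R ^+ (l - k) * w); rewrite y2E mulrA -exprD subnKC.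
- have y0 : - (c * u'^-1) * y1 + 1 * y2 = 0.
    rewrite y1E y2E; transitivity (2%:R ^+ k * c * (1 - u'^-1 * u')); first by ring.
    by rewrite uu' subrr mulr0.
  case: (ltnP k i) => ki.
    have [t tE] : exists t, i = (k + t).+1 by exists (i - k.+1)%N; lia.
    exists 1, 0, (- (c * u'^-1)), 1; split; first by rewrite !parE.
    exists k, t, 0, 0, u, u'; split=> //; left; rewrite y0.
    by split; rewrite ?y1E ?z2E ?tE ?exprS ?exprD; ring.
  have [t tE] : exists t, k = (i + t)%N by exists (k - i)%N; lia.
  exists (- (c * u'^-1)), 1, 1, 0; split; first by rewrite !parE andbF.
  exists i, t, 0, 0, u', u; split=> //; right; rewrite y0.
  by split; rewrite ?y1E ?z2E ?tE ?exprD; ring.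
case: (leqP i l) => il.
  have [s sE] : exists s, l = (i + s)%N by exists (l - i)%N; lia.
  have [t tE] : exists t, k = (i + t)%N by exists (k - i)%N; lia.
  exists 0, 1, 1, 0; split; first by rewrite !parE.
  exists i, t, 0, (2%:R ^+ s * w), u', u; split=> //; right.
  by split; rewrite ?y1E ?z2E ?y2E ?sE ?tE ?exprD; ring.
have ww : w^-1 * w = 1 by rewrite mulVr.
have [s sE] : exists s, i = (l + s).+1 by exists (i - l.+1)%N; lia.
have [t tE] : exists t, k = (l + t)%N by exists (k - l)%N; lia.
exists 0, 1, 1, (- (2%:R ^+ t * u' * w^-1)); split; first by rewrite !parE.
exists l, (t + s)%N, (2%:R ^+ s * u), 0, (- (u' * w^-1 * u)), w.
split=> //; first by rewrite !parE pu' pu parV.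
left; rewrite y1E z2E y2E sE tE; split; rewrite ?exprS ?exprD; try ring.
transitivity (2%:R ^+ l * 2%:R ^+ t * u' * (1 - w^-1 * w)); first by ring.
by rewrite ww; ring.
Qed.

Lemma has_normal_basis_change (z1 y1 z2 y2 u1 u2 v1 v2 : Z2) : par (u1 * v2 - u2 * v1) ->
  has_normal_basis (u1 * z1 + u2 * z2) (u1 * y1 + u2 * y2)
                   (v1 * z1 + v2 * z2) (v1 * y1 + v2 * y2) ->
  has_normal_basis z1 y1 z2 y2.
Proof.
move=> puv [a1 [a2 [b1 [b2 [pab nb]]]]].
exists (a1 * u1 + a2 * v1), (a1 * u2 + a2 * v2), (b1 * u1 + b2 * v1), (b1 * u2 + b2 * v2).
split.
  have -> : (a1 * u1 + a2 * v1) * (b1 * u2 + b2 * v2)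
      - (a1 * u2 + a2 * v2) * (b1 * u1 + b2 * v1) =
      (a1 * b2 - a2 * b1) * (u1 * v2 - u2 * v1) by ring.
  by rewrite parM pab puv.
have E s t x1 x2 : (s * u1 + t * v1) * x1 + (s * u2 + t * v2) * x2 =
  s * (u1 * x1 + u2 * x2) + t * (v1 * x1 + v2 * x2) :> Z2 by ring.
by rewrite !E.
Qed.

Lemma normal_basis_exists (z1 y1 z2 y2 : Z2) : z1 * y2 - z2 * y1 != 0 ->
  has_normal_basis z1 y1 z2 y2.
Proof.
move=> dT; have [[c z1E]|[c z2E]] := z2_dvd_total z1 z2.
  apply: (@has_normal_basis_change _ _ _ _ 1 (- c) 0 1); first by rewrite !parE andbF.
  rewrite (_ : 1 * z1 + - c * z2 = 0); last by rewrite z1E; ring.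
  apply: has_normal_basis0; apply: contraNneq dT => E; apply/eqP.
    transitivity (- z2 * (1 * y1 + - c * y2)); first by rewrite z1E; ring.
    by rewrite E mulr0.
  have z20 : z2 = 0 by rewrite -E; ring.
  by rewrite z1E z20; ring.
apply: (@has_normal_basis_change _ _ _ _ (- c) 1 1 0); first by rewrite !parE andbF.
rewrite (_ : - c * z1 + 1 * z2 = 0); last by rewrite z2E; ring.
apply: has_normal_basis0; apply: contraNneq dT => E; apply/eqP.
  transitivity (z1 * (- c * y1 + 1 * y2)); first by rewrite z2E; ring.
  by rewrite E mulr0.
have z10 : z1 = 0 by rewrite -E; ring.
by rewrite z2E z10; ring.
Qed.

(** The map T obtained for one large [J] approximates a solution of N_2 = - D o T. For smaller j,
    subtracting its equation leaves a difference of two pullbacks of D; j is chosen so that 2^(j+1)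
    is the scale excluded by the matching core lemma. *)
Lemma plane_not_universal (d e k n11 n12 n22 : Z2) : par d -> par e ->
  n11 * n22 - n12 * n12 != 0 ->
  (k = 0 \/ [/\ par k, par n11 = false & par n22 = false]) ->
  (forall j, (0 < j)%N -> exists s11 s12 s21 s22, forall a b, par a || par b ->
     exists w, nz4 w /\ qD d e k (s11 * a + s12 * b) (s21 * a + s22 * b) +
       (n11 * a * a + 2%:R * n12 * a * b + n22 * b * b) = 2%:R ^+ j.+1 * w) ->
  False.
Proof.
move=> pd pe /z2_decomp[dl [u0 [pu0 dnE]]] kP H.
(* [dl] is the valuation of det N_2; the exponents j used below are at most 2 [dl] + 1. *)
have [J JE] : exists J, J = (2 * dl + 10)%N by eexists.
have J0 : (0 < J)%N by rewrite JE addn_gt0 orbT.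
have [t11 [t12 [t21 [t22 HT]]]] := H J J0.
pose nf a b := n11 * a * a + 2%:R * n12 * a * b + n22 * b * b.
have [|w1 [_ E1]] := HT 1 0; first by rewrite par1.
have [|w2 [_ E2]] := HT 0 1; first by rewrite par1 orbT.
have [|w3 [_ E3]] := HT 1 1; first by rewrite par1.
pose dT := t11 * t22 - t12 * t21.
(* Modulo 2^J, det N_2 is det D times the square of det T, which bounds the valuation of det T. *)
have [f fE] : exists f, 2%:R ^+ dl * u0 = (2%:R * d * e - k * k) * dT * dT + 2%:R ^+ J * f.
  have n11E : n11 = 2%:R ^+ J * (2%:R * w1) - qD d e k t11 t21.
    apply: (eq_of_scaled_sub (oner_neq0 Z2) E1); rewrite /qD [2%:R ^+ J.+1]exprS; ring.
  have n22E : n22 = 2%:R ^+ J * (2%:R * w2) - qD d e k t12 t22.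
    apply: (eq_of_scaled_sub (oner_neq0 Z2) E2); rewrite /qD [2%:R ^+ J.+1]exprS; ring.
  pose Db := d * t11 * t12 + k * (t11 * t22 + t12 * t21) + 2%:R * e * t21 * t22.
  have n12E : n12 = 2%:R ^+ J * (w3 - w1 - w2) - Db.
    apply: (eq_of_scaled_sub z2_2neq0 E3); rewrite /Db n11E n22E /qD [2%:R ^+ J.+1]exprS; ring.
  rewrite -dnE n11E n22E n12E; set K := 2%:R ^+ J.
  exists (4%:R * K * w1 * w2 - 2%:R * w1 * qD d e k t12 t22 - 2%:R * w2 * qD d e k t11 t21
     - K * (w3 - w1 - w2) * (w3 - w1 - w2) + 2%:R * (w3 - w1 - w2) * Db).
  by rewrite /dT /Db /qD; ring.
have dT_bound p x v : par v -> dT * v = 2%:R ^+ p * x -> (p <= dl)%N.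
  move=> pv E; rewrite leqNgt; apply/negP => lp.
  have vv : v^-1 * v = 1 by rewrite mulVr.
  have : (dl.+1 <= dl)%N; last by rewrite ltnn.
  have dTE : dT = 2%:R ^+ dl.+1 * (2%:R ^+ (p - dl.+1) * x * v^-1).
    rewrite !mulrA -exprD subnKC // -E.
    by transitivity (dT * (v^-1 * v)); [rewrite vv mulr1 | ring].
  have JE' : 2%:R ^+ J = 2%:R ^+ dl.+1 * 2%:R ^+ (J - dl.+1) :> Z2.
    by rewrite -exprD; congr (_ ^+ _); clear -JE; lia.
  set g := 2%:R ^+ (p - dl.+1) * x * v^-1 in dTE.
  apply: (@pow2_dvd_odd dl dl.+1 u0 ((2%:R * d * e - k * k) * dT * g
     + 2%:R ^+ (J - dl.+1) * f)) => //.
  rewrite fE JE'; transitivity ((2%:R * d * e - k * k) * dT * (2%:R ^+ dl.+1 * g)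
     + 2%:R ^+ dl.+1 * 2%:R ^+ (J - dl.+1) * f); first by rewrite -dTE.
  by ring.
have dT0 : t11 * t22 - t12 * t21 != 0.
  apply/eqP => dT0; have : (dl.+1 <= dl)%N; last by rewrite ltnn.
  by apply: (dT_bound _ 0 1); rewrite ?par1 // /dT dT0 mul0r mulr0.
have [a1 [a2 [b1 [b2 [pab [q [r [X [Y [U [V [pU pV nb]]]]]]]]]]]] := normal_basis_exists dT0.
have diffP j : (0 < j)%N -> (j.+2 <= J)%N -> exists xa ya xb yb,
    diff4 d e k (2%:R ^+ j.+1) xa ya xb yb
      (a1 * t11 + a2 * t12) (a1 * t21 + a2 * t22)
      (b1 * t11 + b2 * t12) (b1 * t21 + b2 * t22).
  move=> j0 jJ; have [s11 [s12 [s21 [s22 HS]]]] := H j j0.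
  exists (a1 * s11 + a2 * s12), (a1 * s21 + a2 * s22),
         (b1 * s11 + b2 * s12), (b1 * s21 + b2 * s22) => s t pst.
  have pst' : par (s * a1 + t * b1) || par (s * a2 + t * b2).
    move: pab pst; rewrite !parE; case: (par a1); case: (par a2); case: (par b1);
    by case: (par b2); case: (par s); case: (par t).
  have [w [nw Ew]] := HS _ _ pst'; have [w' [_ Ew']] := HT _ _ pst'.
  (* As J - j is at least 2, the correction is a multiple of 4 and preserves [nz4]. *)
  exists (w - 2%:R ^+ (J - j) * w'); split.
    move=> y yE; apply: (nw (y + 2%:R ^+ (J - j.+2) * w')).
    apply: (eq_of_scaled_sub (oner_neq0 Z2) yE); rewrite (_ : (J - j = (J - j.+2).+2)%N); last by clear -jJ; lia.
    by rewrite !exprS; ring.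
  have <- : 2%:R ^+ j.+1 * w - 2%:R ^+ J.+1 * w' = 2%:R ^+ j.+1 * (w - 2%:R ^+ (J - j) * w').
    rewrite -{1}(_ : j + (J - j) = J)%N; last by clear -jJ; lia.
    by rewrite -addSn exprD; ring.
  by rewrite -Ew -Ew' /qD; ring.
have dTab : dT * (a1 * b2 - a2 * b1) =
   (a1 * t11 + a2 * t12) * (b1 * t21 + b2 * t22) - (a1 * t21 + a2 * t22) * (b1 * t11 + b2 * t12).
  by rewrite /dT; ring.
have par_a : par (qD d e k (a1 * t11 + a2 * t12) (a1 * t21 + a2 * t22)) =
    (par n11 && par a1) (+) (par n22 && par a2).
  have [|w [_ /(congr1 par)]] := HT a1 a2.
    by move: pab; rewrite !parE; case: (par a1); case: (par a2).
  rewrite /qD !parE /=.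
  case: (par n11); case: (par n22); case: (par a1); case: (par a2);
  by case: (par t11); case: (par t12); case: (par d).
move: diffP dTab par_a; case: nb => [] [-> -> -> ->] diffP dTab par_a.
  have p_le : ((q + r).+1 <= dl)%N.
    apply: (dT_bound (q + r).+1 (2%:R ^+ q * (2%:R * X * Y - V * U)) _ pab).
    by rewrite dTab exprS exprD; ring.
  have PE : 2%:R * 2%:R ^+ q * 2%:R ^+ r = 2%:R ^+ (q + r).+1 :> Z2.
    by rewrite exprS exprD; ring.
  case: kP => [k0|[pk _ _]].
    have [||xa [ya [xb [yb]]]] := diffP (2 * (q + r).+1)%N; [by [] | clear -p_le JE; lia |].
    rewrite exprS mul2n -addnn exprD mulrA -PE.
    exact: core_split_even.
  have [||xa [ya [xb [yb]]]] := diffP (2 * (q + r) + 1)%N; [by rewrite addn1 | clear -p_le JE; lia |].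
  rewrite (_ : (2 * (q + r) + 1).+1 = (q + r).+1 + (q + r).+1)%N; last by clear; lia.
  rewrite exprD -PE.
  exact: core_unimod_even.
have p_le : (q + r <= dl)%N.
  apply: (dT_bound (q + r)%N (2%:R ^+ q * (V * U - 2%:R * X * Y)) _ pab).
  by rewrite dTab exprD; ring.
have PE : 2%:R ^+ q * 2%:R ^+ r = 2%:R ^+ (q + r) :> Z2 by rewrite exprD.
case: kP => [k0|[pk pn1 pn2]].
  have [||xa [ya [xb [yb]]]] := diffP (2 * (q + r) + 1)%N; [by rewrite addn1 | clear -p_le JE; lia |].
  rewrite (_ : (2 * (q + r) + 1).+1 = 2 + ((q + r) + (q + r)))%N; last by clear; lia.
  rewrite (_ : 2%:R ^+ _ = 4%:R * (2%:R ^+ q * 2%:R ^+ r) * (2%:R ^+ q * 2%:R ^+ r)).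
    exact: core_split_odd.
  by rewrite !exprD; ring.
(* If q = r = 0, the value at the first basis vector is odd, yet it has the parity of a value of the
   even form N_2. This makes j = 2(q + r) positive. *)
have q0 : (0 < q + r)%N.
  rewrite lt0n; apply/negP; rewrite addn_eq0 => /andP[/eqP q0 _].
  by move: par_a; rewrite q0 /qD !parE pd pV pn1 pn2.
have [||xa [ya [xb [yb]]]] := diffP (2 * (q + r))%N; [by rewrite muln_gt0 | clear -p_le JE; lia |].
rewrite exprS mul2n -addnn exprD mulrA -PE.
exact: core_unimod_odd.
Qed.

(** Let c be the valuation of [n]. If c is odd, j = c fails: [t] is odd and the two terms have
    valuations of different parity, so the sum has valuation at most c. If c = 2b, then j = c + 2
    gives 8 | d + u; for b > 0, j = c would make 2w divisible by 8, against [nz4]. So b = 0 and u =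
    n. *)
Lemma binary_good (d n : Z2) : par d -> n != 0 ->
  (forall j, (0 < j)%N -> exists s t w, [/\ par s || par t, nz4 w &
     d * s * s + n * t * t = 2%:R ^+ j.+1 * w]) ->
  exists y, d + n = 8%:R * y.
Proof.
move=> pd /z2_decomp[c [u [pu nE]]] H.
have dvd_sq p s x : d * s * s = 2%:R ^+ p * 2%:R ^+ p * x -> exists s', s = 2%:R ^+ p * s'.
  move=> E; have [|s' [_ [-> _]]] := @qD_dvd_even d 1 0 pd par1 p s 0 x; last by exists s'.
  by rewrite -E /qD; ring.
have [b [cE|cE]] : exists b, c = (b + b)%N \/ c = (b + b).+1.
  exists c./2; rewrite addnn -[X in X = _ \/ X = _]odd_double_half.
  by case: (odd c); [right|left].
- have small j w s t : nz4 w -> par s || par t -> (b + b <= j)%N ->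
      d * s * s + n * t * t = 2%:R ^+ j.+1 * w ->
      exists s', [/\ par s', par t & d * s' * s' + u * t * t = 2%:R ^+ (j - (b + b)).+1 * w].
    move=> nw pst bj; rewrite -{1}(subnKC bj) -addnS !exprD nE cE exprD => E.
    set K := 2%:R ^+ (j - (b + b)).+1 in E *.
    have [|s' s'E] := @dvd_sq b s (K * w - u * t * t).
      by apply: (eq_of_scaled_sub (oner_neq0 Z2) E); ring.
    have E' : d * s' * s' + u * t * t = K * w.
      apply: (eq_of_scaled_sub _ E); first exact: (mulf_neq0 (pow2_neq0 b) (pow2_neq0 b)).
      by rewrite s'E; ring.
    have ps' : par s' = par t.
      have := congr1 par E'; rewrite /K exprS !parE pd pu.
      by case: (par s'); case: (par t).
    exists s'; rewrite ps'; suff pt : par t by [].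
    move: pst; rewrite s'E parM ps'; case: (par t) => //=; by rewrite andbF.
  have sum8 s' t x : par s' -> par t -> d * s' * s' + u * t * t = x ->
      exists y, d + u = x + 8%:R * y.
    move=> /sq_odd8[f fE] /sq_odd8[g gE] <-; exists (- (d * f + u * g)).
    by rewrite -!mulrA fE gE; ring.
  have [s [t [w [pst nw E]]]] := H (b + b).+2 isT.
  have [|s' [ps' pt]] := small (b + b).+2 w s t nw pst _ E; first by rewrite -addn2 leq_addr.
  rewrite (_ : ((b + b).+2 - (b + b) = 2)%N); last by rewrite -addn2 addKn.
  move=> /(sum8 _ _ _ ps' pt)[y yE].
  have [y' {y yE} duE] : exists y, d + u = 8%:R * y.
    by exists (w + y); rewrite yE !exprS; ring.
  case: b cE small H {dvd_sq s t w pst nw E s' ps' pt} => [|b] cE small H.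
    by exists y'; rewrite nE cE expr0 mul1r.
  have [s [t [w [pst nw E]]]] := H (b.+1 + b.+1)%N isT.
  have [s' [ps' pt]] := small _ w s t nw pst (leqnn _) E.
  rewrite subnn expr1 => /(sum8 _ _ _ ps' pt)[y yE]; case: (nw (y' - y)).
  by apply: (eq_of_scaled_sub z2_2neq0 (esym yE)); rewrite duE; ring.
have [|s [t [w [pst nw E]]]] := H c; first by rewrite cE.
have pt : par t.
  have := congr1 par E; rewrite nE cE !exprS !parE pd.
  by case: (par s) pst; case: (par t).
have [|s' [y' [sE _]]] := @qD_dvd_odd d 1 0 pd par1 b s 0 (2%:R * w - u * t * t).
  apply: (eq_of_scaled_sub (oner_neq0 Z2) E); rewrite /qD nE cE !exprS exprD; ring.
have {}E : 2%:R * (d * s' * s' - w) = - (u * t * t).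
  apply: (eq_of_scaled_sub (pow2_neq0 (b + b).+1) E); rewrite sE nE cE !exprS exprD; ring.
by have := congr1 par E; rewrite !parE pu pt.
Qed.

(** * Primitive 4-universality *)

Definition wuniv m (G : 'M[Z2]_m) : Prop :=
  forall A : 'M[Z2]_4, is_lattice A ->
    exists X : 'M_(m, 4), prim X /\ X^T *m G *m X = A.

Lemma wuniv_eqv m (G P : 'M_m) : P \in unitmx -> wuniv G -> wuniv (P^T *m G *m P).
Proof.
move=> uP uG A /uG[X [pX XGX]]; exists (invmx P *m X); split.
  by move=> c; rewrite -mulmxA => /(evM P); rewrite mulKVmx // => /pX.
rewrite -{}XGX trmx_mul -!mulmxA mulKVmx // [(invmx P)^T *m _]mulmxA -trmx_mul.
by rewrite mulmxV // trmx1 mul1mx.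
Qed.

Lemma dsum_eqv m n (A : 'M[Z2]_m) (N P : 'M_n) :
  (dsum 1%:M P)^T *m dsum A N *m dsum 1%:M P = dsum A (P^T *m N *m P).
Proof.
rewrite /dsum tr_block_mx !trmx0 trmx1 !mulmx_block.
by rewrite !(mulmx0, mul0mx, addr0, add0r, mul1mx, mulmx1).
Qed.

Lemma dsum_unitmx n m (P : 'M[Z2]_n) : P \in unitmx -> dsum (1%:M : 'M_m) P \in unitmx.
Proof. by rewrite !unitmxE det_dsum det1 mul1r. Qed.

Lemma det_eqv m (G P : 'M[Z2]_m) : P \in unitmx -> \det G != 0 -> \det (P^T *m G *m P) != 0.
Proof.
rewrite unitmxE => uP dG; rewrite !det_mulmx det_tr.
by rewrite !mulf_neq0 //; apply: contraTneq uP => ->; rewrite unitr0.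
Qed.

Definition K4 : 'M[Z2]_(2 + 2) := dsum (mk2 2%:R 1 2%:R) (mk2 4%:R 2%:R 4%:R).

Lemma nrm_odd (a b : Z2) : par a || par b -> par (a * a + a * b + b * b).
Proof. by rewrite !parE; case: (par a); case: (par b). Qed.

Lemma K4_value c : bf K4 c c = 2%:R *
  ((usubmx c 0 0 * usubmx c 0 0 + usubmx c 0 0 * usubmx c 1 0 + usubmx c 1 0 * usubmx c 1 0)
  + 2%:R * (dsubmx c 0 0 * dsubmx c 0 0 + dsubmx c 0 0 * dsubmx c 1 0
     + dsubmx c 1 0 * dsubmx c 1 0)).
Proof. by rewrite bf_dsumE !bf_mk2; ring. Qed.

(** The form a^2 + ab + b^2 is odd unless a and b are both even. In that case it is divisible by 4,
    and the summand 2 A_2 contributes twice an odd number. *)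
Lemma K4_nz4 c : ~ ev c -> exists w, nz4 w /\ bf K4 c c = 2%:R * w.
Proof.
rewrite K4_value; set a := usubmx c 0 0; set b := usubmx c 1 0.
set s := dsubmx c 0 0; set t := dsubmx c 1 0 => nc; eexists; split; last by [].
case: (boolP (par a || par b)) => [/nrm_odd pN|].
  by apply: nz4_odd; rewrite parD pN !parE.
rewrite negb_or => /andP[/negPf pa /negPf pb].
have [a' ->] := z2_half pa; have [b' ->] := z2_half pb.
rewrite (_ : _ + _ = 2%:R * (2%:R * (a' * a' + a' * b' + b' * b') + (s * s + s * t + t * t))); last by ring.
apply: nz4_dbl; rewrite parD (nrm_odd (a := s)) ?parE //.
apply: contra_notT nc; rewrite negb_or => /andP[/negPf ps /negPf pt].
by rewrite -[c]vsubmxK; apply/ev_col; split; apply/ev_vec2.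
Qed.

Lemma lattice_scale j m (A : 'M[Z2]_m) : is_lattice A -> is_lattice (2%:R ^+ j *: A).
Proof.
move=> [AT dA]; split; first by rewrite linearZ /= AT.
by rewrite detZ mulf_neq0 // expf_neq0 // pow2_neq0.
Qed.

Lemma lattice_dsum_mk2 a b c a' b' c' : a * c - b * b != 0 -> a' * c' - b' * b' != 0 ->
  is_lattice (dsum (mk2 a b c) (mk2 a' b' c') : 'M_4).
Proof.
move=> d1 d2; split; first by apply: (dsum_tr (mk2 a b c) (mk2 a' b' c')).2; rewrite !mk2_tr.
have := det_dsum (mk2 a b c) (mk2 a' b' c'); rewrite !det_mk2 => dE.
by apply: contra_neq (mulf_neq0 d1 d2) => <-; rewrite dE.
Qed.

Lemma par_neq0 (x : Z2) : par x -> x != 0.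
Proof. by apply: contraTneq => ->. Qed.

Lemma K4_lattice : is_lattice (K4 : 'M_4).
Proof.
apply: lattice_dsum_mk2; first by apply: par_neq0; rewrite !parE.
have -> : 4%:R * 4%:R - 2%:R * 2%:R = 4%:R * 3%:R :> Z2 by ring.
by rewrite mulf_neq0 ?z2_4neq0 //; apply: par_neq0; rewrite par_nat.
Qed.

Lemma wuniv_good m (G : 'M_m) j : wuniv G -> exists X : 'M_(m, 4), good j G X.
Proof.
move=> /(_ _ (lattice_scale j K4_lattice))[X [pX XGX]]; exists X; split=> // c nc.
rewrite bf_mulmx XGX bf_scale; have [w [nw ->]] := K4_nz4 nc.
by exists w; split=> //; rewrite exprS; ring.
Qed.

Lemma stuck_drop n k (N : 'M_n) (X : 'M_(2 + n, k)) : N^T = N ->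
  stuck (dsum HH N) X -> prim X ->
  [/\ stuck N (dsubmx X), prim (dsubmx X) & forall c, exists a,
     bf N (dsubmx X *m c) (dsubmx X *m c) =
     bf (dsum HH N) (X *m c) (X *m c) + 8%:R * a].
Proof.
move=> NT sX pX; split; first exact: (stuck_dsub sX).
  exact: (stuck_dsub_prim NT sX pX).
by move=> c; have [a ->] := stuck_value NT sX c; exists (- a); ring.
Qed.

(** Two independent vectors of 2 A_2 serve in turn to cancel two hyperbolic planes. The images of
    A_2 then lie in H + <d, n> and contradict [singular_even_arf]; a step that cannot be carried out
    contradicts the values of <d, n> directly. *)
Lemma K4_not_represented d n y : par d -> d + n = 8%:R * y ->
  ~ wuniv (dsum HH (dsum HH (dsum HH (mk2 d 0 n)))).
Proof.
move=> pd dn; set N2 := mk2 d 0 n; set N4 := dsum HH N2; set N6 := dsum HH N4.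
have pn : par n by have := congr1 par dn; rewrite !parE pd; case: (par n).
have N2T : N2^T = N2 by exact: mk2_tr.
have N4T : N4^T = N4 by exact: dsumHH_sym.
have N6T : N6^T = N6 by exact: dsumHH_sym.
have GT : (dsum HH N6)^T = dsum HH N6 by exact: dsumHH_sym.
move=> /(_ _ K4_lattice)[X' [pX' XGX]].
have [X [pX BX]] : exists X : 'M_(2 + (2 + (2 + 2)), 2 + 2), prim X /\
    forall c c', bf (dsum HH N6) (X *m c) (X *m c') = bf K4 c c'.
  by exists X'; split=> // c c'; rewrite bf_mulmx XGX.
pose V (u v : 'cV[Z2]_2) := X *m col_mx u v.
have BV u v u' v' : bf (dsum HH N6) (V u v) (V u' v') =
    bf (mk2 2%:R 1 2%:R) u u' + bf (mk2 4%:R 2%:R 4%:R) v v' by rewrite BX bf_dsum.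
have B4 v v' : exists a, bf (mk2 4%:R 2%:R 4%:R) v v' = 2%:R * a.
  exists (bf (mk2 2%:R 1 2%:R) v v'); rewrite !bf_mk2; ring.
have Q4 v : ~ ev v -> exists a, par a /\ bf (mk2 4%:R 2%:R 4%:R) v v = 4%:R * a.
  move=> nv; exists (v 0 0 * v 0 0 + v 0 0 * v 1 0 + v 1 0 * v 1 0); split.
    apply/nrm_odd; apply: contra_notT nv; rewrite negb_or => /andP[/negPf ? /negPf ?].
    exact/ev_vec2.
  by rewrite bf_mk2; ring.
have evV v : ev (V 0 v) -> ev v by move=> /pX /ev_col[].
(* Otherwise the image of 2 A_2 is stuck in all three planes and projects onto <d, n>, whose values
   would all be even although [d] is odd. *)
have [c0 [g0 [pg0 pb0]]] : exists c0 g0, par (bf (dsum HH N6) g0 g0) = false /\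
    par (bf (dsum HH N6) (V 0 c0) g0).
  apply: contrapT => none; pose X2 : 'M_(_, 2) := X *m col_mx 0 1%:M.
  have X2E c : X2 *m c = V 0 c by rewrite -mulmxA mul_col_mx mul0mx mul1mx.
  have sX2 : stuck (dsum HH N6) X2.
    move=> c g pg; apply/negP => pb; apply: none; exists c, g; split=> //.
    by rewrite -X2E.
  have pX2 : prim X2 by move=> c; rewrite X2E => /evV.
  have [s1 p1 v1] := stuck_drop N6T sX2 pX2.
  have [s2 p2 v2] := stuck_drop N4T s1 p1.
  have [s3 p3 v3] := stuck_drop N2T s2 p2.
  have : even_lattice N2.
    apply: (even_of_prim p3) => c; have [a3 ->] := v3 c; have [a2 ->] := v2 c.
    have [a1 ->] := v1 c; have [b bE] := B4 c c.
    by rewrite X2E BV bf0l bE !parE.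
  by move=> /(_ (vec2 1 0)); rewrite bf_mk2 !vec2_0 !vec2_1 !parE pd /= andbF.
have nc0 : ~ ev c0.
  move=> ec; move: pb0; rewrite bf_ev_l //; apply/evM/ev_col; split=> //.
  by exists 0; rewrite scaler0.
have [c1 nc1] : exists c1, forall a, ~ ev (c1 - a *: c0).
  case p0: (par (c0 0 0)).
    exists (vec2 0 1) => a /ev_vec2; rewrite !mxE /= !parE p0 => -[].
    by case: (par a).
  have p1 : par (c0 1 0).
    by apply/negP => /negP/negPf p1; apply: nc0; apply/ev_vec2.
  exists (vec2 1 0) => a /ev_vec2; rewrite !mxE /= !parE p0 p1 => -[].
  by rewrite andbF.
have [h [_ Qc0]] := Q4 c0 nc0.
have Qx0 : bf (dsum HH N6) (V 0 c0) (V 0 c0) = 4%:R * h by rewrite BV bf0l add0r.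
have [k0 Qg0] := z2_half pg0.
have [g [Qg Bg]] := hyp_complete GT Qx0 Qg0 pb0.
have Qx0' : bf (dsum HH N6) (V 0 c0) (V 0 c0) = (2%:R * h) *+ 2 by rewrite Qx0; ring.
have [Pi [PiB Piev]] := hyp_proj N6T Qx0' Qg Bg.
pose a z := bf (dsum HH N6) z g.
pose z u v := V u (v - a (V u v) *: c0).
have zE u v : z u v = V u v - a (V u v) *: V 0 c0.
  rewrite /z /V [_ *: (X *m _)]scalemxAr -mulmxBr; congr (X *m _).
  by rewrite scale_col_mx scaler0 opp_col_mx add_col_mx oppr0 addr0.
have zg u v : bf (dsum HH N6) (z u v) g = 0.
  by rewrite zE !bfE Bg mulr1 subrr.
pose e1 := vec2 1 0; pose e2 := vec2 0 1.
(* [y1] and [y2] come from a basis of A_2, [y4] from [c1], independent of [c0] modulo 2. The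
   corrections lie in 2 A_2, where B is even and Q divisible by 4, so the parities survive. *)
have [y1 [y2 [y4 [q1 [q2 [q4 [[pq1 Q1] [pq2 Q2] [pq4 Qy4] [p12 p14 p24 ny4]]]]]]]] :
    exists y1 y2 y4 q1 q2 q4, [/\ par q1 /\ bf N6 y1 y1 = 2%:R * q1,
      par q2 /\ bf N6 y2 y2 = 2%:R * q2, par q4 /\ bf N6 y4 y4 = 4%:R * q4 &
      [/\ par (bf N6 y1 y2), par (bf N6 y1 y4) = false, par (bf N6 y2 y4) = false
         & ~ ev y4]].
  have Q4' v : exists b, bf (mk2 4%:R 2%:R 4%:R) v v = 4%:R * b.
    by exists (v 0 0 * v 0 0 + v 0 0 * v 1 0 + v 1 0 * v 1 0); rewrite bf_mk2; ring.
  set A := mk2 2%:R 1 2%:R in BV.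
  have PB u v u' v' : bf N6 (Pi *m z u v) (Pi *m z u' v') =
      bf A u u' +
      bf (mk2 4%:R 2%:R 4%:R) (v - a (V u v) *: c0) (v' - a (V u' v') *: c0).
    by rewrite PiB ?BV; [ | exact: zg | exact: zg].
  have [b1 b1E] := Q4' (0 - a (V e1 0) *: c0).
  have [b2 b2E] := Q4' (0 - a (V e2 0) *: c0).
  have [b4 [pb4 b4E]] := Q4 _ (nc1 (a (V 0 c1))).
  exists (Pi *m z e1 0), (Pi *m z e2 0), (Pi *m z 0 c1), (1 + 2%:R * b1), (1 + 2%:R * b2), b4.
  have A11 : bf A e1 e1 = 2%:R by rewrite bf_mk2 !vec2_0 !vec2_1; ring.
  have A12 : bf A e1 e2 = 1 by rewrite bf_mk2 !vec2_0 !vec2_1; ring.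
  have A22 : bf A e2 e2 = 2%:R by rewrite bf_mk2 !vec2_0 !vec2_1; ring.
  split.
  - by split; [rewrite !parE | rewrite (PB e1 0 e1 0) b1E A11; ring].
  - by split; [rewrite !parE | rewrite (PB e2 0 e2 0) b2E A22; ring].
  - by split; [exact: pb4 | rewrite (PB 0 c1 0 c1) b4E (bf0l A 0) add0r].
  split.
  - rewrite (PB e1 0 e2 0) A12.
    by have [f ->] := B4 (0 - a (V e1 0) *: c0) (0 - a (V e2 0) *: c0); rewrite !parE.
  - rewrite (PB e1 0 0 c1) (bf0r A e1) add0r.
    by have [f ->] := B4 (0 - a (V e1 0) *: c0) (c1 - a (V 0 c1) *: c0); rewrite !parE.
  - rewrite (PB e2 0 0 c1) (bf0r A e2) add0r.
    by have [f ->] := B4 (0 - a (V e2 0) *: c0) (c1 - a (V 0 c1) *: c0); rewrite !parE.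
  move=> /Piev ez; apply: (nc1 (a (V 0 c1))); apply: evV; apply: ez => //.
  by rewrite BV bf0l add0r; have [b ->] := B4 (c1 - a (V 0 c1) *: c0) c0; rewrite !parE.
have ZN2 : singular_even N2.
  move=> v; rewrite bf_mk2 !parE pd pn /= => par_eq.
  have p01 : par (v 0 0) = par (v 1 0).
    by move: par_eq; case: (par (v 0 0)); case: (par (v 1 0)).
  case p0: (par (v 0 0)).
    have [f fE] := sq_odd8 p0; have [f' fE'] := sq_odd8 (etrans (esym p01) p0).
    exists (2%:R * (y + d * f + n * f')).
    transitivity (d * (1 + 8%:R * f) + n * (1 + 8%:R * f')).
      by rewrite -fE -fE'; ring.
    transitivity (d + n + 8%:R * (d * f + n * f')); first by ring.
    by rewrite dn; ring.
  have [f ->] := z2_half p0; have [f' ->] := z2_half (etrans (esym p01) p0).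
  by exists (d * f * f + n * f' * f'); ring.
have scal (c : 'cV[Z2]_1) : y4 *m c = c 0 0 *: y4.
  by apply/matrixP => i j; rewrite mxE big_ord1 [RHS]mxE (ord1 j) mulrC.
have py4 : prim y4.
  move=> c; rewrite scal => ec; apply/evP => i; rewrite (ord1 i).
  by apply/negP => pc; apply/ny4/(evZ_odd pc).
(* If [y4] is stuck, its component in <d, n> is primitive of even norm, so both coordinates are odd
   and the norm is divisible by 8, while Q(y4) is 4 times an odd number. *)
case: (pselect (stuck N6 y4)) => [sy4|].
  have [s1 p1 v1] := stuck_drop N4T sy4 py4.
  have [s2 p2 v2] := stuck_drop N2T s1 p1.
  have [f1 v1E] := v1 1%:M; have [f2] := v2 1%:M; rewrite v1E !mulmx1 Qy4.
  set t := dsubmx _ in p2 *; rewrite bf_mk2 => tE.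
  have ev1 : ~ ev (1%:M : 'cV[Z2]_1) by move/evP/(_ 0); rewrite mxE par1.
  have nt : ~ ev t by rewrite -[t]mulmx1 => /p2.
  have pt : par (t 0 0) = par (t 1 0).
    have := congr1 par tE; rewrite !parE pd pn /=.
    by case: (par (t 0 0)); case: (par (t 1 0)).
  case p0: (par (t 0 0)); last by apply/nt/ev_vec2; rewrite -pt.
  have [h0 h0E] := sq_odd8 p0; have [h1 h1E] := sq_odd8 (etrans (esym pt) p0).
  have q4E : q4 = 2%:R * (y + d * h0 + n * h1 - f1 - f2).
    have nE : n = 8%:R * y - d by rewrite -dn; ring.
    apply: (eq_of_scaled_sub z2_4neq0 (esym tE)).
    transitivity (4%:R * q4 + 8%:R * f1 + 8%:R * f2
        - (d * (1 + 8%:R * h0) + n * (1 + 8%:R * h1))); first by rewrite nE; ring.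
    by rewrite -h0E -h1E; ring.
  by move: pq4; rewrite q4E !parE.
move=> /existsNP[c /existsNP[g1 /not_implyP[pg1 /eqP]]].
rewrite eqbF_neg negbK scal bfZl parM => /andP[_ pb1].
have [k1 Qg1] := z2_half pg1.
have [g' [Qg' Bg']] := hyp_complete N6T Qy4 Qg1 pb1.
have Qy4' : bf N6 y4 y4 = (2%:R * q4) *+ 2 by rewrite Qy4; ring.
have [Pi' [PiB' _]] := hyp_proj N4T Qy4' Qg' Bg'.
pose b v := bf N6 v g'.
have wg v : bf N6 (v - b v *: y4) g' = 0 by rewrite !bfE Bg' mulr1 subrr.
have B41 : bf N6 y4 y1 = bf N6 y1 y4 by rewrite bfC.
have B42 : bf N6 y4 y2 = bf N6 y2 y4 by rewrite bfC.
have [f1 f1E] := z2_half p14; have [f2 f2E] := z2_half p24.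
apply: (@singular_even_arf _ N2 (Pi' *m (y1 - b y1 *: y4)) (Pi' *m (y2 - b y2 *: y4))
  (q1 - 2%:R * b y1 * f1 + 2%:R * b y1 * b y1 * q4)
  (q2 - 2%:R * b y2 * f2 + 2%:R * b y2 * b y2 * q4)) => //.
- by rewrite PiB' // !bfE B41 f1E Q1 Qy4; ring.
- by rewrite PiB' // !bfE B42 f2E Q2 Qy4; ring.
- by rewrite !parE pq1.
- by rewrite !parE pq2.
- by rewrite PiB' // !bfE B42 f1E f2E Qy4 !parE p12 /= !andbF.
Qed.

(** * Complements of rank 4 without hyperbolic pairs *)

Lemma sym_mk2 (N : 'M[Z2]_2) : N^T = N -> N = mk2 (N 0 0) (N 0 1) (N 1 1).
Proof.
move=> NT; apply/matrixP => i j; rewrite mxE; move: i j.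
apply: I2P; apply: I2P => //=.
by rewrite -{1}NT mxE.
Qed.

Lemma bf_sym2 (N : 'M_2) a b : N^T = N -> bf N (vec2 a b) (vec2 a b) =
  N 0 0 * a * a + 2%:R * N 0 1 * a * b + N 1 1 * b * b.
Proof.
by move=> NT; rewrite {1}(sym_mk2 NT) bf_mk2 vec2_0 vec2_1; ring.
Qed.

(** As the values are divisible by 4, an even N_2-part forces an even D-part. So the projection of
    the plane to N_2 is invertible, and the plane is a graph. *)
Lemma good_plane_split d e k (N2 : 'M_2) j (Y : 'M_(2 + 2, 2)) :
  par d -> par e -> N2^T = N2 -> (0 < j)%N ->
  good j (dsum (mk2 d k (2%:R * e)) N2) Y ->
  exists s11 s12 s21 s22, forall a b, par a || par b -> exists w, nz4 w /\
    qD d e k (s11 * a + s12 * b) (s21 * a + s22 * b) +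
    (N2 0 0 * a * a + 2%:R * N2 0 1 * a * b + N2 1 1 * b * b) = 2%:R ^+ j.+1 * w.
Proof.
move=> pd pe N2T j0 gY; have [pY vY] := gY.
have QE c : bf (dsum (mk2 d k (2%:R * e)) N2) (Y *m c) (Y *m c) =
    qD d e k ((usubmx Y *m c) 0 0) ((usubmx Y *m c) 1 0) +
    bf N2 (dsubmx Y *m c) (dsubmx Y *m c).
  by rewrite bf_dsumE bf_mk2 !mul_usub_mx !mul_dsub_mx /qD; ring.
have GT : (dsum (mk2 d k (2%:R * e)) N2)^T = dsum (mk2 d k (2%:R * e)) N2.
  by apply/dsum_tr; rewrite mk2_tr.
have pT : prim (dsubmx Y).
  move=> c ec; apply: pY; rewrite -[Y *m c]vsubmxK -mul_usub_mx -mul_dsub_mx.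
  apply/ev_col; split=> //; have [w Qw] := good4 j0 gY c.
  move: Qw; rewrite QE; have [t ->] := ec; rewrite bfZl bfZr => Qw.
  have [|z [y [zE yE]]] := @qD_dvd_even d e k pd pe 1 ((usubmx Y *m c) 0 0)
      ((usubmx Y *m c) 1 0) (w - bf N2 t t).
    by apply: (eq_of_scaled_sub (oner_neq0 Z2) Qw); rewrite expr1; ring.
  by apply/ev_vec2; rewrite zE yE expr1 !parE.
have uT := prim_unitmx pT; set S := usubmx Y *m invmx (dsubmx Y).
have SE a b i : (S *m vec2 a b) i 0 = S i 0 * a + S i 1 * b.
  by rewrite mxE !big_ord_recl big_ord0 lift01 !mxE addr0.
exists (S 0 0), (S 0 1), (S 1 0), (S 1 1) => a b pab.
have [|w [nw Ew]] := vY (invmx (dsubmx Y) *m vec2 a b).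
  move=> /(evM (dsubmx Y)); rewrite mulKVmx // => /ev_vec2.
  by rewrite vec2_0 vec2_1; move: pab; case: (par a); case: (par b) => // _ [].
exists w; split=> //; rewrite -Ew QE mulKVmx // !mulmxA -/S -!SE.
by rewrite bf_sym2.
Qed.

Definition even_pairs m (N : 'M_m) : Prop :=
  forall u v, par (bf N u u) = false -> par (bf N v v) = false -> par (bf N u v) = false.

Lemma split_plane_contra d e k (N2 : 'M_2) : par d -> par e -> N2^T = N2 -> \det N2 != 0 ->
  k = 0 \/ par k -> even_pairs (dsum (mk2 d k (2%:R * e)) N2) ->
  (forall j, (0 < j)%N -> exists Y : 'M_(2 + 2, 2),
     good j (dsum (mk2 d k (2%:R * e)) N2) Y) -> False.
Proof.
move=> pd pe N2T dN2 kP evp H.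
(* A vector of odd norm in [N2] added to the one of norm [d] would give an even vector pairing oddly
   with the one of norm 2e. *)
have N2even : par k -> even_lattice N2.
  move=> pk t; apply/negP => pt.
  have := evp (col_mx (vec2 0 1) 0) (col_mx (vec2 1 0) t).
  rewrite !bf_dsum !bf_mk2 !vec2_0 !vec2_1 !(bf0l N2).
  by rewrite !parE pk pd pt /= => /(_ erefl erefl).
apply: (@plane_not_universal d e k (N2 0 0) (N2 0 1) (N2 1 1)) => //.
- by have := dN2; rewrite {1}(sym_mk2 N2T) det_mk2.
- case: kP => [->|pk]; [by left | right; split=> //].
    by have := N2even pk (vec2 1 0); rewrite bf_sym2 // !mulr1 !mulr0 !addr0.
  by have := N2even pk (vec2 0 1); rewrite bf_sym2 // !mulr1 !mulr0 !add0r.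
- by move=> j j0; have [Y gY] := H j j0; apply: (good_plane_split pd pe N2T j0 gY).
Qed.

Lemma even_pairs_eqv m (N P : 'M_m) : even_pairs N -> even_pairs (P^T *m N *m P).
Proof. by move=> evp u v; rewrite -!bf_mulmx; apply: evp. Qed.

Lemma trmx_mul_entry m k (G : 'M[Z2]_m) (X : 'M_(m, k)) i j :
  (X^T *m G) i j = ((col i X)^T *m G) 0 j.
Proof. by rewrite tr_col -row_mul [RHS]mxE. Qed.

Lemma bf_delta m (G : 'M[Z2]_m) (x : 'cV_m) j : (x^T *m G) 0 j = bf G x (delta_mx j 0).
Proof. by rewrite /bf -colE [RHS]mxE. Qed.

Lemma even_row_mx m k (N : 'M_m) (T : 'M_(m, k)) (o : 'cV_m) : N^T = N ->
  (forall c, par (bf N (T *m c) (T *m c)) = false) -> par (bf N o o) = false ->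
  forall c, par (bf N (row_mx T o *m c) (row_mx T o *m c)) = false.
Proof.
by move=> NT QT po c; rewrite row_mx_col1 parQD // QT parQZ po andbF.
Qed.

(** Some [u0] has norm 2e with e odd. If an odd vector pairs oddly with it, the two span a
    unimodular ramified plane; otherwise [u0] is made orthogonal to [o] and the plane is diagonal.
    Either plane splits off, which [split_plane_contra] excludes. *)
Lemma no_hyp_contra (N : 'M_(2 + 2)) : N^T = N -> \det N != 0 ->
  (exists o, par (bf N o o)) -> ~ singular_even N -> ~ (exists e f, hyperbolic N e f) ->
  (forall j, (0 < j)%N -> exists Y : 'M_(2 + 2, 2), good j N Y) -> False.
Proof.
move=> NT dN [o po] nZ nhyp H.
have hypP x0 g0 : (exists h, bf N x0 x0 = 4%:R * h) -> par (bf N g0 g0) = false ->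
    par (bf N x0 g0) = false.
  move=> [h Qx] /z2_half[l Qg]; apply/negP => pb; apply: nhyp.
  have [g [Qg' Bg]] := hyp_complete NT Qx Qg pb.
  have Bgx : bf N g x0 = 1 by rewrite bfC.
  exists (x0 - (2%:R * h) *: g), g; split; [|exact: Qg'|].
    by rewrite !bfE Qx Qg' Bg Bgx; ring.
  by rewrite !bfE Qg' Bg; ring.
(* Otherwise the columns of a good plane [Y] with [u], [v] and [o] would be five vectors independent
   modulo 2 in rank 4. *)
have evp : even_pairs N.
  move=> u v pu pv; apply/negP => puv; have [Y gY] := H 1%N isT.
  have QY c : par (bf N (Y *m c) (Y *m c)) = false.
    by have [w ->] := good4 (isT : (0 < 1)%N) gY c; rewrite !parE.
  have Yv c : par (bf N (Y *m c) v) = false by apply: hypP => //; exact: (good4 _ gY).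
  have Yu c : par (bf N (Y *m c) u) = false by apply: hypP => //; exact: (good4 _ gY).
  have p1 : prim (row_mx Y u).
    apply: prim_row_mx => [|c a /(bf_ev_l N v)]; first by have [] := gY.
    by rewrite !bfE parD parM puv andbT Yv.
  have Q1 := even_row_mx NT QY pu.
  have p2 : prim (row_mx (row_mx Y u) v).
    apply: prim_row_mx => // c a /(bf_ev_l N u); rewrite row_mx_col1 !bfE !parD !parM.
    by rewrite Yu pu andbF [bf N v u]bfC // puv andbT.
  have Q2 := even_row_mx NT Q1 pv.
  have p3 : prim (row_mx (row_mx (row_mx Y u) v) o).
    apply: prim_row_mx => // c a /(bf_ev_l N (row_mx (row_mx Y u) v *m c + a *: o)).
    by rewrite parQD // Q2 parQZ po andbT.
  by have := prim_leq p3.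
have [u0 [e [pe Qu0]]] : exists u0 e, par e /\ bf N u0 u0 = 2%:R * e.
  move: nZ => /existsNP[u0 /not_implyP[/z2_half[e Qe] ne]]; exists u0, e; split=> //.
  apply: contrapT => /negP/negPf/z2_half[e' eE]; apply: ne; exists e'.
  by rewrite Qe eE; ring.
have contra_split (x y : 'cV_(2 + 2)) W k e' : par (bf N x x) -> par e' ->
    bf N x y = k -> bf N y y = 2%:R * e' -> k = 0 \/ par k ->
    \det (mk2 (bf N x x) k (2%:R * e')) != 0 ->
    (row_mx x y)^T *m N = mk2 (bf N x x) k (2%:R * e') *m W -> False.
  move=> px pe' Bxy Qy kP dA XN.
  have XNX : (row_mx x y)^T *m N *m row_mx x y = mk2 (bf N x x) k (2%:R * e').
    by rewrite (@gram2 _ N x y NT) Bxy Qy.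
  have [P [N2 [uP _ PNP]]] := @split_dsum 2 2 N (row_mx x y) _ W NT XNX XN dA.
  apply: (@split_plane_contra (bf N x x) e' k N2) => //.
  - exact: dsum_sym_r PNP.
  - have := det_eqv uP dN; rewrite PNP det_dsum.
    by apply: contraNneq => ->; rewrite mulr0.
  - by rewrite -PNP; exact: even_pairs_eqv.
  - move=> j j0; have [Y gY] := H j j0; exists (invmx P *m Y).
    by rewrite -PNP; exact: good_eqv.
case: (pselect (exists o', par (bf N o' o') && par (bf N o' u0))) => [[o' /andP[po' pk]]|none].
  have uA : mk2 (bf N o' o') (bf N o' u0) (2%:R * e) \in unitmx.
    by rewrite unitmxE unitZ2 det_mk2 !parE pk andbF.
  apply: (contra_split o' u0 (invmx (mk2 (bf N o' o') (bf N o' u0) (2%:R * e)) *m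
      ((row_mx o' u0)^T *m N)) (bf N o' u0) e) => //.
  - by right.
  - by move: uA; rewrite unitmxE; apply: contraTneq => ->; rewrite unitr0.
  - by rewrite mulKVmx.
have evu0 v : par (bf N v u0) = false.
  case pv: (par (bf N v v)); last by apply: evp => //; rewrite Qu0 !parE.
  by apply/negP => pb; apply: none; exists v; rewrite pv pb.
set d := bf N o o in po; have dd : d^-1 * d = 1 by rewrite mulVr.
have [k kE] := z2_half (evu0 o).
have [u1 u1E] : exists u1, u1 = u0 - (d^-1 * (2%:R * k)) *: o by eexists.
have Bou1 : bf N o u1 = 0.
  rewrite u1E !bfE kE -/d; transitivity (2%:R * k * (1 - d^-1 * d)); first by ring.
  by rewrite dd subrr mulr0.
have Qu1 : bf N u1 u1 = 2%:R * (e - 2%:R * d^-1 * k * k).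
  rewrite {1}u1E bfDl bfNl bfZl Bou1 mulr0 subr0 u1E !bfE Qu0 [bf N u0 o]bfC // kE; ring.
have evu1 v : par (bf N u1 v) = false.
  by rewrite u1E !bfE [bf N u0 v]bfC // !parE evu0 andbF.
set e1 := e - 2%:R * d^-1 * k * k in Qu1.
have pe1 : par e1 by rewrite /e1 !parE pe.
(* All pairings with [u1] are even, so projection onto the span of [o] and [u1] is integral although
   its Gram matrix is not unimodular. *)
have /choice[h hE] : forall j, exists y, (u1^T *m N) 0 j = 2%:R * y.
  by move=> j; apply: z2_half; rewrite bf_delta.
pose W : 'M_(2, 2 + 2) := \matrix_(i, j)
   if i == 0 then d^-1 * (o^T *m N) 0 j else e1^-1 * h j.
apply: (contra_split o u1 W 0 e1) => //; first by left.
  rewrite det_mk2 -/d mul0r subr0 !mulf_neq0 ?z2_2neq0 ?par_neq0 //.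
have ee : e1^-1 * e1 = 1 by rewrite mulVr.
have W0 j : W 0 j = d^-1 * (o^T *m N) 0 j by rewrite mxE.
have W1 j : W 1 j = e1^-1 * h j by rewrite mxE.
have AW i j : (mk2 d 0 (2%:R * e1) *m W) i j =
    mk2 d 0 (2%:R * e1) i 0 * W 0 j + mk2 d 0 (2%:R * e1) i 1 * W 1 j.
  by rewrite [LHS]mxE !big_ord_recl big_ord0 lift01 addr0.
have M00 : mk2 d 0 (2%:R * e1) 0 0 = d by rewrite mxE.
have M01 : mk2 d 0 (2%:R * e1) 0 1 = 0 by rewrite mxE.
have M10 : mk2 d 0 (2%:R * e1) 1 0 = 0 by rewrite mxE.
have M11 : mk2 d 0 (2%:R * e1) 1 1 = 2%:R * e1 by rewrite mxE.
apply/matrixP => i j; rewrite trmx_mul_entry -/d AW W0 W1; move: i.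
apply: I2P.
  rewrite col0_row_mx M00 M01 mul0r addr0 mulrA [d * _]mulrC dd mul1r //.
rewrite col1_row_mx M10 M11 mul0r add0r hE.
transitivity ((e1^-1 * e1) * (2%:R * h j)); last by ring.
by rewrite ee mul1r.
Qed.

(** * Ranks at most 8 *)

Lemma par_dsumHH n (N : 'M_n) x :
  par (bf (dsum HH N) x x) = par (bf N (dsubmx x) (dsubmx x)).
Proof.
by rewrite bf_dsumE bf_mk2 !parE /=; case: (par (usubmx x 0 0)); case: (par (usubmx x 1 0)).
Qed.

Lemma wuniv_odd n (N : 'M_n) : wuniv (dsum HH (dsum HH N)) -> exists o, par (bf N o o).
Proof.
have l1 : is_lattice (1%:M : 'M_4) by split; rewrite ?trmx1 // det1 oner_neq0.
move=> /(_ _ l1)[X [_ XGX]].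
have : par (bf (dsum HH (dsum HH N)) (X *m delta_mx 0 0) (X *m delta_mx 0 0)).
  by rewrite bf_mulmx XGX /bf mulmx1 trmx_delta mul_delta_mx mxE.
by rewrite !par_dsumHH; set o := dsubmx _; exists o.
Qed.

Lemma wuniv_pair m (G : 'M_m) a b c : a * c - b * b != 0 -> wuniv G ->
  exists e f u v, [/\ hyperbolic G e f, bf G u f = 0, bf G v f = 0,
    (bf G u e = 0 /\ bf G v e = 0) &
    [/\ bf G u u = a, bf G u v = b & bf G v v = c]].
Proof.
move=> dA /(_ (dsum HH (mk2 a b c)))[|X [_ XGX]].
  apply: lattice_dsum_mk2 => //.
  by rewrite mul0r mulr1 sub0r oppr_eq0 oner_neq0.
have BX (u v u' v' : 'cV[Z2]_2) :
    bf G (X *m (col_mx u v : 'cV_(2 + 2))) (X *m (col_mx u' v' : 'cV_(2 + 2))) =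
    bf HH u u' + bf (mk2 a b c) v v'.
  by rewrite -bf_dsum -XGX; exact: bf_mulmx.
exists (X *m (col_mx (vec2 1 0) 0 : 'cV_(2 + 2))), (X *m (col_mx (vec2 0 1) 0 : 'cV_(2 + 2))).
exists (X *m (col_mx 0 (vec2 1 0) : 'cV_(2 + 2))), (X *m (col_mx 0 (vec2 0 1) : 'cV_(2 + 2))).
have b0l z : bf HH 0 z = 0 := bf0l HH z.
have b0l' z : bf (mk2 a b c) 0 z = 0 := bf0l _ z.
have b0r' z : bf (mk2 a b c) z 0 = 0 := bf0r _ z.
have vE a' b' c' s t s' t' : bf (mk2 a' b' c') (vec2 s t) (vec2 s' t') =
    a' * (s * s') + b' * (s * t' + t * s') + c' * (t * t').
  by rewrite bf_mk2 !vec2_0 !vec2_1.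
split; [split | | | split | split]; rewrite BX.
all: rewrite ?b0l ?b0l' ?b0r' ?vE; ring.
Qed.

Lemma wuniv_split n (G : 'M_(2 + n)) : G^T = G -> wuniv G ->
  exists P N, [/\ P \in unitmx, N^T = N & P^T *m G *m P = dsum HH N].
Proof.
move=> GT uG; have [|e [f [_ [_ [ef _ _ _ _]]]]] := @wuniv_pair _ G 1 0 1 _ uG.
  by rewrite mulr1 mulr0 subr0 oner_neq0.
exact: split_hyp ef.
Qed.

(** Represent the sum of H and the given binary form; what is orthogonal to the copy of H projects
    isometrically into [N]. *)
Lemma wuniv_proj n (N : 'M_n) a b c : N^T = N -> a * c - b * b != 0 ->
  wuniv (dsum HH N) ->
  exists u v, [/\ bf N u u = a, bf N u v = b & bf N v v = c].
Proof.
move=> NT dA uG; have [e [f [u [v [[Qe Qf Bef] uf vf _ [<- <- <-]]]]]] := wuniv_pair dA uG.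
have [|Pi [PiB _]] := @hyp_proj n N NT e f 0 _ Qf Bef; first by rewrite Qe mul0rn.
by exists (Pi *m u), (Pi *m v); rewrite !PiB.
Qed.

Lemma wuniv_not_singular n (N : 'M_n) : N^T = N -> wuniv (dsum HH (dsum HH N)) ->
  ~ singular_even N.
Proof.
move=> NT uG ZN; have [||u [v [Qu Buv Qv]]] := @wuniv_proj _ (dsum HH N) 2%:R 1 2%:R _ _ uG.
- exact: dsumHH_sym.
- by apply: par_neq0; rewrite !parE.
by apply: (@singular_even_arf n N u v 1 1 NT ZN); rewrite ?Qu ?Qv ?Buv ?mulr1 ?par1.
Qed.

(** Two reductions take the frame from rank 4 to rank 2. Stuck at the first, [N] would be even;
    stuck at the second, it would contain a primitive sublattice of rank 3 with values divisible by
    4, hence be [singular_even]. *)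
Lemma good_planes (N : 'M_(2 + 2)) j : N^T = N -> wuniv (dsum HH (dsum HH N)) ->
  (0 < j)%N -> exists Y : 'M_(2 + 2, 2), good j N Y.
Proof.
move=> NT uG j0; have HNT := dsumHH_sym NT; have GT := dsumHH_sym HNT.
have [o po] := wuniv_odd uG; have nZ := wuniv_not_singular NT uG.
have [X gX] := wuniv_good j uG.
have [[Y gY]|sX] := good_reduce_or_stuck (k := 3) HNT j0 gX; last first.
  have [pX _] := gX; have [s1 p1 v1] := stuck_drop HNT sX pX.
  have [s2 p2 v2] := stuck_drop NT s1 p1.
  have /(_ o) : even_lattice N.
    apply: (even_of_prim p2) => c; have [a2 ->] := v2 c; have [a1 ->] := v1 c.
    by have [w ->] := good4 j0 gX c; rewrite !parE.
  by rewrite po.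
have [[Z gZ]|sY] := good_reduce_or_stuck (k := 2) NT j0 gY; first by exists Z.
have [pY _] := gY; have [_ p1 v1] := stuck_drop NT sY pY.
case: nZ; apply: (@singular_even_of_span 3 N (dsubmx Y) o) => // c.
have [a1 ->] := v1 c; have [w ->] := good4 j0 gY c.
by exists (w + 2%:R * a1); ring.
Qed.

Lemma dsum11 (A B : 'M[Z2]_1) : dsum A B = mk2 (A 0 0) 0 (B 0 0).
Proof.
have E0 : (0 : 'I_2) = lshift 1 (0 : 'I_1) by exact: val_inj.
have E1 : (1 : 'I_2) = rshift 1 (0 : 'I_1) by exact: val_inj.
apply/matrixP => i j; rewrite [RHS]mxE; move: i j; apply: I2P; apply: I2P => /=.
- by rewrite E0; exact: (@block_mxEul Z2 1 1 1 1).
- by rewrite E0 E1; apply: (etrans (@block_mxEur Z2 1 1 1 1 _ _ _ _ _ _)); rewrite mxE.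
- by rewrite E0 E1; apply: (etrans (@block_mxEdl Z2 1 1 1 1 _ _ _ _ _ _)); rewrite mxE.
- by rewrite E1; exact: (@block_mxEdr Z2 1 1 1 1).
Qed.

Lemma diagonalize2 (N : 'M_(1 + 1)) o : N^T = N -> par (bf N o o) ->
  exists P d n, [/\ P \in unitmx, par d & P^T *m N *m P = mk2 d 0 n].
Proof.
move=> NT po; pose A := o^T *m N *m o.
have uA : A \in unitmx by rewrite unitmxE det_mx11.
have [||P [N1 [uP _ PNP]]] := @split_dsum 1 1 N o A (invmx A *m (o^T *m N)) NT erefl.
- by rewrite mulKVmx.
- by apply: contraTneq uA => dA; rewrite unitmxE dA unitr0.
by exists P, (A 0 0), (N1 0 0); rewrite PNP dsum11.
Qed.

Lemma rank4_contra (N : 'M_(2 + 2)) : N^T = N -> \det N != 0 ->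
  ~ wuniv (dsum HH (dsum HH N)).
Proof.
move=> NT dN uG; have planes j (j0 : (0 < j)%N) := good_planes NT uG j0.
have [o po] := wuniv_odd uG; have nZ := wuniv_not_singular NT uG.
case: (pselect (exists e f, hyperbolic N e f)) => [[e [f ef]]|nh]; last first.
  by apply: (no_hyp_contra NT dN _ nZ nh planes); exists o.
have [P [N2 [uP N2T PNP]]] := split_hyp NT ef.
have {}uG : wuniv (dsum HH (dsum HH (dsum HH N2))).
  rewrite -PNP -!dsum_eqv; apply: wuniv_eqv => //.
  by do 2!apply: dsum_unitmx.
have [o2 po2] : exists o2, par (bf N2 o2 o2).
  exists (dsubmx (invmx P *m o)); rewrite -par_dsumHH -PNP -bf_mulmx mulKVmx //.
have dN2 : \det N2 != 0.
  have := det_eqv uP dN; rewrite PNP det_dsum; apply: contraNneq => ->.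
  by rewrite mulr0.
have [P2 [d [n [uP2 pd PN2P]]]] := diagonalize2 N2T po2.
have {}uG : wuniv (dsum HH (dsum HH (dsum HH (mk2 d 0 n)))).
  rewrite -PN2P -!dsum_eqv; apply: wuniv_eqv => //.
  by do 3!apply: dsum_unitmx.
have n0 : n != 0.
  have := det_eqv uP2 dN2; rewrite PN2P det_mk2; apply: contraNneq => ->.
  by rewrite mulr0 mul0r subr0.
have [|y dn] := binary_good pd n0; last exact: (K4_not_represented pd dn uG).
move=> j j0; have [Y gY] := planes j j0.
have {}gY := good_eqv uP gY; rewrite PNP in gY.
(* The third reduction yields vectors of [N2]; if it were stuck, [N2] would be even. *)
have [[Z gZ]|sY] := good_reduce_or_stuck (k := 1) N2T j0 gY; last first.
  have [pY _] := gY; have [_ p1 v1] := stuck_drop N2T sY pY.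
  have /(_ o2) : even_lattice N2.
    apply: (even_of_prim p1) => c; have [a1 ->] := v1 c.
    by have [w ->] := good4 j0 gY c; rewrite !parE.
  by rewrite po2.
have {}gZ := good_eqv uP2 gZ; rewrite PN2P in gZ.
have [pZ vZ] := gZ; have n1 : ~ ev (1%:M : 'cV[Z2]_1) by move/evP/(_ 0); rewrite mxE par1.
have [w [nw]] := vZ _ n1; rewrite mulmx1; set z := invmx P2 *m Z => Qz.
exists (z 0 0), (z 1 0), w; split=> //; last by rewrite -Qz bf_mk2; ring.
apply: contra_notT n1; rewrite negb_or => /andP[/negPf p0 /negPf p1].
by apply: pZ; rewrite mulmx1; apply/ev_vec2.
Qed.

Lemma rank8_contra (G : 'M_8) : is_lattice G -> ~ wuniv G.
Proof.
move=> [GT dG] uG; have [P [N [uP NT PGP]]] := @wuniv_split 6 G GT uG.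
have {}uG : wuniv (dsum HH N) by rewrite -PGP; exact: wuniv_eqv.
have dN : \det N != 0.
  have := det_eqv uP dG; rewrite PGP det_dsum; apply: contraNneq => ->.
  by rewrite mulr0.
have [|e [f [Qe Bef Qf]]] := @wuniv_proj _ N 0 1 0 NT _ uG.
  by rewrite mul0r mulr1 sub0r oppr_eq0 oner_neq0.
have [P' [N' [uP' N'T PNP]]] := @split_hyp 4 N e f NT (And3 Qe Qf Bef).
have {}uG : wuniv (dsum HH (dsum HH N')).
  by rewrite -PNP -dsum_eqv; apply: wuniv_eqv => //; exact: dsum_unitmx.
apply: (@rank4_contra N' N'T _ uG).
have := det_eqv uP' dN; rewrite PNP det_dsum; apply: contraNneq => ->.
by rewrite mulr0.
Qed.

Lemma wuniv_dsum1 n (G : 'M_n) : wuniv G -> wuniv (dsum G (1%:M : 'M_1)).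
Proof.
move=> uG A /uG[X [pX XGX]]; exists (col_mx X 0); split.
  by move=> c; rewrite mul_col_mx => /ev_col[/pX].
by rewrite tr_col_mx trmx0 mul_row_block mul_row_col !(mulmx0, mul0mx, addr0).
Qed.

(** Adding <1> preserves universality, so smaller ranks reduce to rank 8 by induction on the deficit
    [k]. *)
Lemma rank_le8_contra k n (G : 'M_n) : (n + k = 8)%N -> is_lattice G -> ~ wuniv G.
Proof.
elim: k n G => [|k IH] n G; first by rewrite addn0 => n8; subst n; exact: rank8_contra.
rewrite addnS -addSn -addn1 => /IH{}IH [GT dG] /wuniv_dsum1; apply: IH.
split; first by apply/dsum_tr; rewrite trmx1.
by rewrite det_dsum det1 mulr1.
Qed.

(** If X c = 2v and v = X u + w with w in the complement, then X (c - 2u) = 2w lies in both summands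
    and vanishes; [X] is injective because det A is nonzero. *)
Lemma prim_universal_wuniv m (G : 'M_m) : prim_universal 4 G -> wuniv G.
Proof.
move=> uG A AL; have [X [XGX [C [[C0 [CD CZ]] [SC SC0]]]]] := uG A AL.
exists X; split=> // c [v XcE]; have [s [w [[u ->] [Cw vE]]]] := SC v.
have Xinj (b : 'cV_4) : X *m b = 0 -> b = 0.
  move=> Xb; apply: (mulmx_det_inj AL.2); rewrite mulmx0 -XGX -mulmxA Xb.
  by rewrite mulmx0.
exists u; apply/eqP; rewrite -subr_eq0; apply/eqP/Xinj.
have E : X *m (c - 2%:R *: u) = 2%:R *: w.
  by rewrite mulmxBr XcE vE scalerDr -scalemxAr addrC addKr.
by apply: SC0; [exists (c - 2%:R *: u) | rewrite E; exact: CZ].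
Qed.

(** * Rank 9 *)

(** H^4 + <1>, with the first vectors of the four hyperbolic pairs grouped together, then the second
    ones. The matrix is its own inverse. *)
Definition G9 : 'M[Z2]_(4 + (4 + 1)) :=
  block_mx 0 (row_mx 1%:M 0) (col_mx 1%:M 0) (dsum 0 1%:M).

Lemma G9_lattice : is_lattice G9.
Proof.
split.
  rewrite /G9 tr_block_mx tr_row_mx tr_col_mx !trmx0 !trmx1.
  by rewrite (_ : (dsum 0 1%:M)^T = dsum 0 1%:M) //; apply/dsum_tr; rewrite trmx0 trmx1.
have : \det (G9 *m G9) != 0; last by rewrite det_mulmx mulf_eq0 negb_or => /andP[].
suff -> : G9 *m G9 = 1%:M by rewrite det1 oner_neq0.
rewrite /G9 mulmx_block mul_row_col mul_col_row /dsum mul_row_block mul_block_col mulmx_block.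
rewrite !(mulmx0, mul0mx, addr0, add0r, mul1mx, mulmx1) row_mx0 col_mx0.
by rewrite add_block_mx !(addr0, add0r) -!scalar_mx_block.
Qed.

Lemma even_diag_split n (M : 'M[Z2]_n) : M^T = M -> (forall i, par (M i i) = false) ->
  exists U : 'M_n, U + U^T = M.
Proof.
move=> MT pM; have /choice[h hE] : forall i, exists y, M i i = 2%:R * y.
  by move=> i; apply: z2_half.
exists (\matrix_(i, j) if (i < j)%N then M i j else if i == j then h i else 0).
apply/matrixP => i j; rewrite !mxE; case: ltngtP => [ij|ij|/val_inj ->].
- by rewrite -val_eqE /= gtn_eqF // addr0.
- by rewrite -val_eqE /= gtn_eqF // add0r -{1}MT mxE.
- by rewrite eqxx hE; ring.
Qed.

Lemma G9_universal : prim_universal 4 G9.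
Proof.
move=> A [AT _]; pose w : 'cV[Z2]_4 := \col_i (par (A i i))%:R.
have [|i|U UE] := @even_diag_split 4 (A - w *m w^T).
- by rewrite linearB /= AT trmx_mul trmxK.
- by rewrite !mxE big_ord1 !mxE !parE; case: (par (A i i)).
pose X : 'M[Z2]_(4 + (4 + 1), 4) := col_mx 1%:M (col_mx U w^T).
have usubX (u : 'cV_4) : usubmx (X *m u) = u by rewrite mul_col_mx col_mxKu mul1mx.
exists X; split.
  rewrite /represents_by /X /G9 !tr_col_mx trmxK trmx1 mul_row_block !mul_row_col.
  rewrite /dsum !mul_mx_row !(mulmx0, mul0mx, mul1mx, mulmx1) row_mx0 !(addr0, add0r).
  by rewrite add_row_mx mul_row_col !(addr0, add0r) mul1mx addrA [U^T + U]addrC UE subrK.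
(* The top block of [X] is the identity, so the vectors with zero top block form a complement of its
   image. *)
exists (fun v => usubmx (v : 'cV_(4 + (4 + 1))) = 0); split; [|split].
- split; first exact: linear0.
  split=> [u v u0 v0|a u u0]; first by rewrite linearD /= u0 v0 addr0.
  by rewrite linearZ /= u0 scaler0.
- move=> v; exists (X *m usubmx (v : 'cV_(4 + (4 + 1)))).
  exists (v - X *m usubmx (v : 'cV_(4 + (4 + 1)))).
  split; first by eexists.
  by rewrite linearB /= usubX subrr addrC subrK.
- by move=> v [u ->]; rewrite usubX => ->; rewrite mulmx0.
Qed.

Theorem theorem6p5 :
  (forall G : 'M[Z2]_8, is_lattice G -> ~ prim_universal 4 G) /\
  u_star_Z2_is 4 9.
Proof.
split=> [G LG /prim_universal_wuniv|]; first exact: rank8_contra.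
split; first by exists G9; split; [exact: G9_lattice | exact: G9_universal].
move=> r G r9 LG /prim_universal_wuniv.
by apply: (@rank_le8_contra (8 - r)%N) => //; rewrite subnKC.
Qed.
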